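(* Let $p\ge2$ be real and let $N$ be an integer with $N\ge 1+p(p-1)$. Set $\Lambda_p:=\left(\frac{N-1}{p}\right)^p$ and $r:=\varrho(x,x_0)$ with $x_0\in\mathbb{H}^N$ fixed, and let $p'=\frac{p}{p-1}$ be the conjugate exponent of $p$. Then for all $u\in C_c^\infty(\mathbb{H}^N)$ $$\left[\int_{\mathbb{H}^N}|\nabla_{\mathbb{H}^N}u|^p\,{\rm d}v_{\mathbb{H}^N}-\Lambda_p\int_{\mathbb{H}^N}|u|^p\,{\rm d}v_{\mathbb{H}^N}\right]\left[\int_{\mathbb{H}^N}|u|^p\,r^{p'}\,{\rm d}v_{\mathbb{H}^N}\right]^{\frac{p}{p'}}\ \ge\ (p-1)\left(\frac{N-1}{p}\right)^{p-2}\left(\frac{p-1}{p}\right)^2\left[\int_{\mathbb{H}^N}|u|^p\,{\rm d}v_{\mathbb{H}^N}\right]^p.$$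
   Context: $\mathbb{H}^N$ is the hyperbolic space of dimension $N$ (constant sectional curvature $-1$); $\nabla_{\mathbb{H}^N}$ and ${\rm d}v_{\mathbb{H}^N}$ denote its Riemannian gradient and Riemannian measure, and $|\nabla_{\mathbb{H}^N}u|$ is the Riemannian norm of the gradient. $\varrho(x,x_0)$ is the geodesic distance between $x$ and $x_0$. *)

(* Defs.v *)
From HB Require Import structures.
From mathcomp Require Import all_boot all_order all_algebra.
From mathcomp Require Import all_classical all_reals all_analysis.

Set Implicit Arguments.
Unset Strict Implicit.
Unset Printing Implicit Defensive.
Import Order.TTheory GRing.Theory Num.Theory.
Import numFieldNormedType.Exports.

Local Open Scope classical_set_scope.
Local Open Scope ring_scope.

Section product_cons.
Context d (T : measurableType d) (R : realType) (n : nat).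
Variables (m1 : {sigma_finite_measure set T -> \bar R})
  (m2 : {sigma_finite_measure set (n.-tuple T) -> \bar R}).
Local Open Scope ereal_scope.

Definition tcons (z : T * n.-tuple T) : n.+1.-tuple T :=
  [tuple of z.1 :: z.2].

Lemma measurable_tcons : measurable_fun setT tcons.
Proof.
exact: (measurable_cons (@measurable_fst _ _ T (n.-tuple T))
  (@measurable_snd _ _ T (n.-tuple T))).
Qed.

Definition product_cons : set (n.+1.-tuple T) -> \bar R :=
  pushforward (m1 \x m2) tcons.

Let product_cons0 : product_cons set0 = 0.
Proof. by rewrite /product_cons /pushforward preimage_set0 measure0. Qed.

Let product_cons_ge0 A : 0 <= product_cons A.
Proof. by rewrite /product_cons /pushforward measure_ge0. Qed.

Let product_cons_sigma_additive : semi_sigma_additive product_cons.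
Proof.
move=> F mF tF mUF; rewrite /product_cons /pushforward preimage_bigcup.
apply: measure_semi_sigma_additive.
- by move=> i; rewrite -[X in measurable X]setTI; apply: measurable_tcons.
- apply/trivIsetP => i j _ _ ij; rewrite -preimage_setI.
  by move/trivIsetP : tF => /(_ i j Logic.I Logic.I ij) ->; rewrite preimage_set0.
- rewrite -preimage_bigcup -[X in measurable X]setTI.
  exact: measurable_tcons.
Qed.

HB.instance Definition _ := isMeasure.Build _ _ _ product_cons
  product_cons0 product_cons_ge0 product_cons_sigma_additive.

Let product_cons_sigma_finite : sigma_finite setT product_cons.
Proof.
have /sigma_finiteP[F [FT ndF Foo]] := sigma_finiteT m1.
have /sigma_finiteP[G [GT ndG Goo]] := sigma_finiteT m2.
pose uncons (t : n.+1.-tuple T) : T * n.-tuple T :=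
  (tnth t ord0, [tuple of behead t]).
have munc : measurable_fun setT uncons.
  apply: measurable_fun_pair; first exact: measurable_tnth.
  exact: measurable_behead.
exists (fun k => uncons @^-1` (F k `*` G k)).
  apply/esym; rewrite -subTset => t _.
  have [i _ Fi] : (\bigcup_i F i) (uncons t).1 by rewrite -FT.
  have [j _ Gj] : (\bigcup_j G j) (uncons t).2 by rewrite -GT.
  exists (maxn i j) => //; split.
    by move: Fi; apply/subsetPset/ndF/leq_maxl.
  by move: Gj; apply/subsetPset/ndG/leq_maxr.
move=> k; have [mF Fk] := Foo k; have [mG Gk] := Goo k; split.
  by rewrite -[X in measurable X]setTI; apply: munc => //; exact: measurableX.
rewrite /product_cons /pushforward -comp_preimage.
rewrite (_ : uncons \o tcons = id); last first.
  by apply/funext => -[x t]; congr pair; apply/val_inj.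
by rewrite preimage_id product_measure1E// lte_mul_pinfty// ge0_fin_numE.
Qed.

HB.instance Definition _ := Measure_isSigmaFinite.Build _ _ _ product_cons
  product_cons_sigma_finite.

End product_cons.

(* n-dimensional Lebesgue measure on R^n, on the product sigma-algebra: the
   library only has it in dimension one. *)
Fixpoint lebesgue_tuple (R : realType) (n : nat) :
    {sigma_finite_measure set (n.-tuple (measurableTypeR R)) -> \bar R} :=
  match n with
  | 0 => \d_([tuple] : 0.-tuple (measurableTypeR R))
  | n'.+1 => product_cons (@lebesgue_measure R) (lebesgue_tuple R n')
  end.

Section hyperbolic_space.
Context {R : realType} {n : nat}.
Local Notation mu := (@lebesgue_measure R).
Implicit Types (u f : 'rV[R]_n.+1 -> R) (x y v w : 'rV[R]_n.+1).

Definition partial (i : 'I_n.+1) f : 'rV[R]_n.+1 -> R :=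
  'D_(delta_mx ord0 i) f.

Fixpoint Ck (k : nat) f : Prop :=
  match k with
  | 0 => continuous f
  | k'.+1 => (forall x, differentiable f x) /\ (forall i, Ck k' (partial i f))
  end.

Definition smooth f := forall k, Ck k f.

(* Upper half-space model of the hyperbolic space of dimension n.+1: the open
   set x_{n+1} > 0 of R^{n+1} with the metric |dx|^2 / x_{n+1}^2, which has
   constant sectional curvature -1. *)
Definition halfspace : set 'rV[R]_n.+1 := [set x | 0 < x ord0 ord_max].

Definition metric x : 'M[R]_n.+1 := ((x ord0 ord_max) ^- 2)%:M.

Definition metric_norm x v : R :=
  Num.sqrt ((v *m metric x *m v^T) ord0 ord0).

(* C_c^oo of the half-space, a function being identified with its extension
   by zero to R^{n+1}. *)
Definition test_function u : Prop :=
  [/\ smooth u, compact (closure [set x | u x != 0]) &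
      closure [set x | u x != 0] `<=` halfspace].

Definition differential_row u x : 'rV[R]_n.+1 := \row_i partial i u x.

(* The row vector w characterized by w *m metric x *m v^T = du_x(v). *)
Definition gradient u x : 'rV[R]_n.+1 :=
  differential_row u x *m invmx (metric x).

Definition row_of_tuple (t : n.+1.-tuple (measurableTypeR R)) : 'rV[R]_n.+1 :=
  \row_i tnth t i.

(* Integral for the Riemannian measure sqrt (det g) dx. *)
Definition hyp_integral f : R :=
  (\int[lebesgue_tuple R n.+1]_(t in row_of_tuple @^-1` halfspace)
     (f (row_of_tuple t) * Num.sqrt (\det (metric (row_of_tuple t)))))%R.

Definition C1_curve (g : R -> 'rV[R]_n.+1) : Prop :=
  (forall t, derivable g t 1) /\ continuous (derive1 g).

(* s lists the right ends of the pieces; on each closed piece the curve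
   agrees with a curve that is C^1 on the whole line, so that one-sided
   derivatives exist and are continuous up to the ends of the piece. *)
Definition piecewise_C1 (g : R -> 'rV[R]_n.+1) : Prop :=
  exists s : seq R, [/\ path <%R 0 s, last 0 s = 1 &
    forall k, (k < size s)%N -> exists2 h, C1_curve h &
      {in `[nth 0 (0 :: s) k, nth 0 s k], g =1 h}].

(* The derivative of a piecewise C^1 curve may fail to exist at finitely many
   points only, which the integral ignores. *)
Definition curve_length (g : R -> 'rV[R]_n.+1) : R :=
  (\int[mu]_(t in `[0%R, 1%R]) metric_norm (g t) (derive1 g t))%R.

Definition joining_curve x y (g : R -> 'rV[R]_n.+1) : Prop :=
  [/\ piecewise_C1 g, {in `[0, 1], forall t, halfspace (g t)},
      g 0 = x & g 1 = y].

Definition geodesic_dist x y : R :=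
  inf [set curve_length g | g in joining_curve x y].

End hyperbolic_space.

(* Main.v *)
Require Import Defs.
From HB Require Import structures.
From mathcomp Require Import all_boot all_order all_algebra.
From mathcomp Require Import all_classical all_reals all_analysis.
From mathcomp Require Import measurable_realfun ring lra.

Set Implicit Arguments.
Unset Strict Implicit.
Unset Printing Implicit Defensive.
Import Order.TTheory GRing.Theory Num.Theory.
Import numFieldNormedType.Exports.

(** Put [a = (N - 1) / p], [q = p / (p - 1)] and [s = cosh r], and let [E], [A],
    [B] be the integrals of [|grad u|^p], [|u|^p] and [|u|^p r^q].

    The inequality comes from a family of linear bounds on [E], one for each
    radius [rho]. Let [X = h(s) grad s] with [h >= 0]. Then [|X| = h(s) sinh r]
    and [div X = h'(s) sinh^2 r + N s h(s)], and the integral of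
    [div (|u|^p X)] vanishes; bounding the cross term
    [p |u|^(p-1) <grad u, X>] by Young's inequality gives
<<
      E >= integral of |u|^p (div X - (p - 1) |X|^q)
>>
    ([weighted_energy]). The field [a^(p-1) grad r] gives the spectral gap
    [a^p], because [div (grad r) >= N - 1]. The fields constructed in
    [radial_profile] are perturbations of it whose weight is at least
    [alpha - beta r^q] everywhere, with [beta >= 0] and
<<
      alpha - beta rho^q >= a^p + K a^(p-2) / rho^p,   K = (p - 1)^3 / p^2.
>>
    A minorant that is affine in [r^q] only sees [A] and [B], so that
    [B <= rho^q A] implies [E >= (a^p + K a^(p-2) / rho^p) A] ([energy_gap]).
    With [rho = (B / A)^(1/q)] this is the claim ([optimize_radius]).

    Two shapes of field are used, and the hypothesis [N >= 1 + p (p - 1)], that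
    is [a >= p - 1], serves both. For [rho <= 5/2] ([near_profile]) the field
    is a multiple of [grad log s], larger than the critical one; its
    weight decreases with [tanh^q r], and as [tanh] is concave this power is at
    most a function affine in [r^q], with equality at [rho]. For [rho >= 5/2] ([far_weight]) the multiple of
    [grad log s] is [a^(p-1) (1 - S / a)] with [S] a function of [log s]; the
    gain over [a^p] is essentially [a^(p-2) (- S' - S^2)]. Taking for [S] the
    logarithmic derivative of [t / sqrt (t^2 + L^2)] makes the gain
    [3 L^2 / (t^2 + L^2)^2], of order [1 / rho^2] near [t = L ~ rho], and
    replacing it by its tangent at [t = L] gives an affine minorant.

    The geometry enters in coordinates: [coshd x0 x] is [cosh r], its gradient
    has squared length [s^2 - 1] ([sum_dcoshd2]) and its Laplacian is [N s]
    ([sum_radial_dflux]). The distance of the statement is an infimum of lengths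
    of curves. That it is at least [arccosh (coshd x0 x)]
    ([geodesic_dist_ge]) follows by integrating the derivative of a function of
    [coshd x0] along a curve; as [B] is increasing in the distance, the other
    half of the equality is replaced by a local bound, which keeps [B] finite
    ([geodesic_dist_bounded]). The divergence theorem reduces to
    [integ_derivative0], integration along coordinate lines and Fubini. *)

Local Open Scope classical_set_scope.
Local Open Scope ring_scope.

(** * Inequalities between powers *)

Section power_inequalities.
Context {R : realType}.
Implicit Types x y p q r : R.

Lemma powR_bernoulli y p : 0 <= y -> 1 < p -> p * (y - 1) <= y `^ p - 1.
Proof.
move=> y0 p1; have p0 : 0 < p by apply: lt_trans p1.
have q0 : 0 < p / (p - 1) by rewrite divr_gt0// subr_gt0.
have pq : p^-1 + (p / (p - 1))^-1 = 1.
  by rewrite invf_div -{1}(div1r p) -mulrDl subrKC mulfV// gt_eqF.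
have := conjugate_powR y0 ler01 p0 q0 pq; rewrite mulr1 powR1 => H.
have {}H : p * y <= p * (y `^ p / p + 1 / (p / (p - 1))) by rewrite ler_pM2l.
have E : p * (y `^ p / p + 1 / (p / (p - 1))) = y `^ p + (p - 1).
  by field; rewrite !gt_eqF ?subr_gt0.
rewrite E in H; lra.
Qed.

Lemma powR_bernoulli_concave y q : 0 <= y -> 0 < q <= 1 ->
  y `^ q <= 1 + q * (y - 1).
Proof.
move=> y0 /andP[q0]; rewrite le_eqVlt => /predU1P[->|q1].
  by rewrite powRr1//; lra.
have := @powR_bernoulli (y `^ q) q^-1 (powR_ge0 _ _).
rewrite -powRrM divff ?gt_eqF// powRr1// => /(_ _)/wrap[].
  by rewrite invf_gt1.
by rewrite ler_pdivrMl// => ?; lra.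
Qed.

(** Jensen's inequality for the points [1] and [y]: Bernoulli's inequality
    bounds both powers from below by the tangent at the mean [z], and the linear
    terms cancel in the mean. *)
Lemma powR_convex_one t y q : 0 <= t <= 1 -> 0 <= y -> 1 < q ->
  (1 - t + t * y) `^ q <= 1 - t + t * y `^ q.
Proof.
move=> /andP[t0 t1] y0 q1; have q0 : 0 < q by apply: lt_trans q1.
set z := 1 - t + t * y.
have z0 : 0 <= z by rewrite addr_ge0 ?mulr_ge0// subr_ge0.
move: z0; rewrite le_eqVlt => /predU1P[<-|z0].
  by rewrite powR0 ?gt_eqF// addr_ge0 ?mulr_ge0 ?powR_ge0// subr_ge0.
have H1 : q * (z^-1 - 1) <= (z^-1) `^ q - 1.
  by apply: powR_bernoulli => //; rewrite invr_ge0 ltW.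
have H2 : q * (y / z - 1) <= (y / z) `^ q - 1.
  by apply: powR_bernoulli => //; rewrite divr_ge0 // ltW.
have zq0 : 0 < z `^ q by rewrite powR_gt0.
have E : (1 - t) * (q * (z^-1 - 1)) + t * (q * (y / z - 1)) = 0.
  have -> : (1 - t) * (q * (z^-1 - 1)) + t * (q * (y / z - 1)) =
     q * ((1 - t + t * y) / z - 1) by field; rewrite gt_eqF.
  by rewrite divff ?gt_eqF// subrr mulr0.
have : (1 - t) * ((z^-1) `^ q - 1) + t * ((y / z) `^ q - 1) >= 0.
  rewrite -E lerD// ler_wpM2l// subr_ge0//.
rewrite powRM ?invr_ge0// ?(ltW z0)//.
have -> : z^-1 `^ q = (z `^ q)^-1.
  by rewrite -[z^-1]powR_inv1 ?(ltW z0)// -powRrM mulN1r powRN.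
move=> H; have : 0 <= z `^ q * ((1 - t) * ((z `^ q)^-1 - 1) +
      t * (y `^ q / z `^ q - 1)) by rewrite mulr_ge0// ltW.
have -> : z `^ q * ((1 - t) * ((z `^ q)^-1 - 1) +
      t * (y `^ q / z `^ q - 1)) = (1 - t + t * y `^ q) - z `^ q.
  by field; rewrite gt_eqF.
by rewrite subr_ge0.
Qed.

Lemma powR_div x y q : 0 <= x -> 0 < y -> (x / y) `^ q = x `^ q / y `^ q.
Proof.
move=> x0 y0; rewrite powRM ?invr_ge0 ?(ltW y0)//.
by rewrite -[in LHS]powR_inv1 ?(ltW y0)// -powRrM mulN1r powRN.
Qed.

(** Bernoulli for the concave power [w^(1/(p-1))]. It trades the conjugate power
    coming from Young's inequality for a quadratic in [w], in which a profile
    given by a Riccati inequality can be expanded exactly. *)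
Lemma powR_conj_quadratic p w : 2 <= p -> 0 <= w ->
  (p - 1) * w `^ (p / (p - 1)) <= (p - 2) * w + w ^+ 2.
Proof.
move=> p2; rewrite le_eqVlt => /predU1P[<-|w0].
  rewrite powR0 ?expr0n ?mulr0 ?addr0//= gt_eqF// divr_gt0//; lra.
have p1 : 0 < p - 1 by lra.
have -> : p / (p - 1) = 1 + (p - 1)^-1 by field; rewrite gt_eqF.
rewrite powRD; last by rewrite (gt_eqF w0) implybT.
rewrite powRr1 ?(ltW w0)//.
have := @powR_bernoulli_concave w (p - 1)^-1 (ltW w0).
rewrite invr_gt0 p1 invf_le1//= => /(_ _)/wrap[]; first by lra.
move=> H; have : (p - 1) * w * w `^ (p - 1)^-1 <= (p - 1) * w * (1 + (p - 1)^-1 * (w - 1)).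
  by rewrite ler_wpM2l// mulr_ge0// ltW.
have -> : (p - 1) * w * (1 + (p - 1)^-1 * (w - 1)) = (p - 2) * w + w ^+ 2.
  by field; rewrite gt_eqF.
by rewrite mulrA.
Qed.

End power_inequalities.

(** * Hyperbolic functions and numerical bounds *)
Section hyperbolic_functions.
Context {R : realType}.
Implicit Types x y r : R.

Definition coshR r : R := (expR r + expR (- r)) / 2.
Definition sinhR r : R := (expR r - expR (- r)) / 2.
Definition tanhR r : R := sinhR r / coshR r.

Lemma coshR_gt0 r : 0 < coshR r.
Proof. by rewrite divr_gt0// addr_gt0 ?expR_gt0. Qed.

Lemma cosh2_sinh2 r : coshR r ^+ 2 - sinhR r ^+ 2 = 1.
Proof.
rewrite /coshR /sinhR expRN; field; rewrite gt_eqF ?expR_gt0//.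
Qed.

Lemma is_derive_cosh r : is_derive r 1 coshR (sinhR r).
Proof.
rewrite /coshR /sinhR.
have H : is_derive r 1 (fun r => expR (- r)) (- expR (- r)).
  by apply: is_derive_eq; rewrite ?mulrN1// /GRing.scale/= mulN1r.
have -> : (fun r => (expR r + expR (- r)) / 2 : R) =
    2^-1 *: (expR + (fun r => expR (- r))).
  by apply/funext => z; rewrite /GRing.scale/= mulrC.
by apply: is_derive_eq; rewrite /GRing.scale/= mulrC.
Qed.

Lemma is_derive_sinh r : is_derive r 1 sinhR (coshR r).
Proof.
rewrite /coshR /sinhR.
have H : is_derive r 1 (fun r => expR (- r)) (- expR (- r)).
  by apply: is_derive_eq; rewrite ?mulrN1// /GRing.scale/= mulN1r.
have -> : (fun r => (expR r - expR (- r)) / 2 : R) =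
    2^-1 *: (expR - (fun r => expR (- r))).
  by apply/funext => z; rewrite /GRing.scale/= mulrC.
by apply: is_derive_eq; rewrite /GRing.scale/= opprK mulrC.
Qed.

End hyperbolic_functions.

Section hyperbolic_bounds.
Context {R : realType}.
Implicit Types x y r rho b : R.

Lemma derivable_everywhere_MVT (f df : R -> R) a b : a <= b ->
  (forall x, is_derive x 1 f (df x)) ->
  exists2 c, a <= c <= b & f b - f a = df c * (b - a).
Proof.
move=> ab fdf; have [|c] := MVT_segment ab (fun x _ => fdf x).
  apply: derivable_within_continuous => x _.
  by have [] := fdf x.
by rewrite in_itv/= => ? ?; exists c.
Qed.

Lemma sinhR0 : sinhR 0 = 0 :> R.
Proof. by rewrite /sinhR oppr0 subrr mul0r. Qed.

Lemma coshR0 : coshR 0 = 1 :> R.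
Proof. by rewrite /coshR oppr0 expR0 divff. Qed.

Lemma sinhR_ge0 r : 0 <= r -> 0 <= sinhR r.
Proof. by move=> r0; rewrite divr_ge0// subr_ge0 ler_expR ge0_cp. Qed.

Lemma sinhR_gt0 r : 0 < r -> 0 < sinhR r.
Proof. by move=> r0; rewrite divr_gt0// subr_gt0 ltr_expR gt0_cp. Qed.

Lemma ler_coshR x y : 0 <= x -> x <= y -> coshR x <= coshR y.
Proof.
move=> x0 xy; have [c /andP[xc cy] E] := derivable_everywhere_MVT xy is_derive_cosh.
by rewrite -subr_ge0 E mulr_ge0 ?subr_ge0// sinhR_ge0// (le_trans x0).
Qed.

Lemma coshR_ge1 r : 0 <= r -> 1 <= coshR r.
Proof. by move=> r0; rewrite -coshR0 ler_coshR. Qed.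

(** [sinh] is convex on the half-line and vanishes at [0]. *)
Lemma sinhR_chord x b : 0 < x <= b -> sinhR x * b <= x * sinhR b.
Proof.
move=> /andP[x0 xb].
have [c /andP[c0 cx]] := derivable_everywhere_MVT (ltW x0) is_derive_sinh.
have [d /andP[xd db]] := derivable_everywhere_MVT xb is_derive_sinh.
rewrite sinhR0 !subr0 => E1 E2.
have H : coshR c <= coshR d by rewrite ler_coshR// (le_trans cx).
have -> : sinhR b = coshR d * (b - x) + sinhR x by rewrite -E1; ring.
rewrite E2 -subr_ge0.
have -> : x * (coshR d * (b - x) + coshR c * x) - coshR c * x * b =
  x * (b - x) * (coshR d - coshR c) by ring.
by rewrite !mulr_ge0 ?subr_ge0// ltW.
Qed.

(** [exp (- x / m) >= 1 - x / m], inverted and raised to the power [m]: an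
    upper bound of [exp] sharp enough for the numerical estimates below. *)
Lemma expR_le_inv (m : nat) x : 0 <= x -> x < m.+1%:R ->
  expR x <= ((1 - x / m.+1%:R)^-1) ^+ m.+1.
Proof.
move=> x0 xm; have d0 : 0 < 1 - x / m.+1%:R by rewrite subr_gt0 ltr_pdivrMr// mul1r.
have -> : expR x = expR (x / m.+1%:R) ^+ m.+1.
  by rewrite -expRM_natl mulrCA divff ?mulr1.
apply: lerXn2r; rewrite ?nnegrE ?expR_ge0 ?invr_ge0 ?(ltW d0)//.
rewrite -[leLHS]invrK -expRN lef_pV2 ?posrE ?expR_gt0//.
by have := expR_ge1Dx (- (x / m.+1%:R)).
Qed.

Lemma sqr_le (x y z : R) : 0 <= x -> x <= y -> y ^+ 2 <= z -> x ^+ 2 <= z.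
Proof. by move=> x0 xy; apply: le_trans; rewrite lerXn2r// nnegrE (le_trans x0). Qed.

Lemma expR1_le : expR 1 <= 14 / 5 :> R.
Proof.
apply: le_trans (expR_le_inv (m := 31) ler01 _) _; first by rewrite (ltr_nat R 1 32).
have -> : (1 - 1 / 32%:R)^-1 = 32 / 31 :> R by field.
have -> (x : R) : x ^+ 32 = ((((x ^+ 2) ^+ 2) ^+ 2) ^+ 2) ^+ 2 by rewrite -!exprM.
have H0 : (0 : R) <= 32 / 31 by lra.
have H1 : ((32 / 31) ^+ 2 : R) <= 1066 / 1000 by lra.
have H2 : (((32 / 31) ^+ 2) ^+ 2 : R) <= 1137 / 1000.
  apply: sqr_le H1 _; rewrite ?exprn_ge0//; lra.
have H3 : ((((32 / 31) ^+ 2) ^+ 2) ^+ 2 : R) <= 1293 / 1000.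
  apply: sqr_le H2 _; rewrite ?exprn_ge0//; lra.
have H4 : (((((32 / 31) ^+ 2) ^+ 2) ^+ 2) ^+ 2 : R) <= 1672 / 1000.
  apply: sqr_le H3 _; rewrite ?exprn_ge0//; lra.
apply: sqr_le H4 _; rewrite ?exprn_ge0//; lra.
Qed.

Lemma sinhR_le_double x : 0 < x <= 1 -> sinhR x <= 2 * x.
Proof.
move=> /[dup] /andP[x0 _] /sinhR_chord; rewrite mulr1 => /le_trans; apply.
rewrite mulrC ler_pM2r//.
rewrite /sinhR; have := expR1_le; have := expR_ge0 (-1 : R); lra.
Qed.

(** Reduces a bound of [exp] at the rational [m / n] to [e <= 14/5] and a
    computation with integer powers. *)
Lemma expR_le_root (n m : nat) x b : (0 < n)%N -> 0 <= b ->
  n%:R * x = m%:R -> (14 / 5) ^+ m <= b ^+ n -> expR x <= b.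
Proof.
move=> n0 b0 E H; rewrite -(@ler_pXn2r _ n) ?nnegrE ?expR_ge0//.
rewrite -expRM_natl E -[m%:R]mulr1 expRM_natl; apply: le_trans H.
by rewrite lerXn2r ?nnegrE ?expR_ge0 ?expR1_le//; lra.
Qed.

Lemma expR_52_le : expR (5 / 2) <= 132 / 10 :> R.
Proof. by apply: (@expR_le_root 2 5) => //; lra. Qed.

Lemma sinhR2_le x : 0 < x <= 5 / 2 -> sinhR x ^+ 2 <= 7 * x ^+ 2.
Proof.
move=> /[dup] /andP[x0 x5] /sinhR_chord H.
have s0 := sinhR_ge0 (ltW x0).
have H1 : sinhR x * (5 / 2) <= x * (66 / 10).
  apply: le_trans H _; rewrite ler_pM2l//.
  by have := expR_52_le; have := expR_ge0 (- (5 / 2) : R); rewrite /sinhR; lra.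
nra.
Qed.

Lemma expR_23_le2 : expR (2 / 3) <= 2 :> R.
Proof. by apply: (@expR_le_root 3 2) => //; lra. Qed.

Lemma expR_78_le : expR (7 / 8) <= 5 / 2 :> R.
Proof. by apply: (@expR_le_root 8 7) => //; lra. Qed.

Lemma tanhR_ge0 r : 0 <= r -> 0 <= tanhR r.
Proof. by move=> r0; rewrite divr_ge0 ?sinhR_ge0// ltW// coshR_gt0. Qed.

Lemma tanhR_gt0 r : 0 < r -> 0 < tanhR r.
Proof. by move=> r0; rewrite divr_gt0 ?sinhR_gt0// coshR_gt0. Qed.

Lemma is_derive_tanh r : is_derive r 1 tanhR ((coshR r ^+ 2)^-1).
Proof.
have c0 : coshR r != 0 by rewrite gt_eqF// coshR_gt0.
have H1 := is_derive_cosh r; have H2 := is_derive_sinh r.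
have H3 := is_deriveV c0 H1.
have -> : tanhR = sinhR * (fun y => (coshR y)^-1) :> (R -> R) by [].
apply: (is_derive_eq (is_deriveM H2 H3)); rewrite /GRing.scale/=.
have E : sinhR r ^+ 2 = coshR r ^+ 2 - 1 by rewrite -(cosh2_sinh2 r); ring.
rewrite mulVf// mulNr mulrN mulrCA -expr2 E; field.
by [].
Qed.

Lemma one_sub_tanh2 r : 1 - tanhR r ^+ 2 = (coshR r ^+ 2)^-1.
Proof.
have c0 : coshR r != 0 by rewrite gt_eqF// coshR_gt0.
have -> : 1 - tanhR r ^+ 2 = (coshR r ^+ 2 - sinhR r ^+ 2) / coshR r ^+ 2.
  by rewrite /tanhR; field.
by rewrite cosh2_sinh2 mul1r.
Qed.

Lemma tanhR_le1 r : 0 <= r -> tanhR r <= 1.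
Proof.
move=> r0; have := one_sub_tanh2 r; have := coshR_gt0 r => c0 E.
have : 0 <= (coshR r ^+ 2)^-1 by rewrite invr_ge0 exprn_ge0// ltW.
rewrite -E subr_ge0 -{1}(expr1n _ 2) => H.
by rewrite -(@ler_pXn2r _ 2) ?nnegrE ?tanhR_ge0.
Qed.

(** The derivative [1 / cosh^2] decreases on the half-line. *)
Lemma tanhR_tangent rho r : 0 <= rho -> 0 <= r ->
  tanhR r <= tanhR rho + (1 - tanhR rho ^+ 2) * (r - rho).
Proof.
move=> rho0 r0; rewrite one_sub_tanh2.
have mono x y : 0 <= x -> x <= y -> (coshR y ^+ 2)^-1 <= (coshR x ^+ 2)^-1.
  move=> x0 xy; rewrite lef_pV2 ?posrE ?exprn_gt0 ?coshR_gt0//.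
  by rewrite lerXn2r ?nnegrE ?(ltW (coshR_gt0 _))// ler_coshR.
have [rr|/ltW rr] := leP rho r.
  have [c /andP[c1 c2] E] := derivable_everywhere_MVT rr is_derive_tanh.
  by rewrite -lerBlDl E ler_wpM2r ?subr_ge0// mono.
have [c /andP[c1 c2] E] := derivable_everywhere_MVT rr is_derive_tanh.
have : (coshR rho ^+ 2)^-1 * (rho - r) <= tanhR rho - tanhR r.
  by rewrite E ler_wpM2r ?subr_ge0// mono// (le_trans r0).
by lra.
Qed.

End hyperbolic_bounds.

(** * Fields adapted to small radii *)
Section near_profile.
Context {R : realType}.
Implicit Types a p r rho : R.

(** The constant [(p - 1) ((p - 1) / p)^2] of the inequality. *)
Definition hardy_const p : R := (p - 1) ^+ 3 / p ^+ 2.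

(** [div X - (p - 1) |X|^q] for the field [X = c v(log cosh r) grad (log cosh r)]
    in dimension [p a + 1], with [v] and [dv] the values of the profile and of
    its derivative at [log cosh r]; the length of [X] is [c v tanh r]. *)
Definition profile_weight p a (c v dv : R) r : R :=
  c * ((dv - v) * tanhR r ^+ 2 + (p * a + 1) * v)
  - (p - 1) * (c * v * tanhR r) `^ (p / (p - 1)).

Lemma expR_ge_quadratic (y : R) : 0 <= y -> 1 + y + y ^+ 2 / 2 <= expR y.
Proof.
move=> y0.
have d (z : R) : is_derive z 1 (fun z : R => expR z - (1 + z + z ^+ 2 / 2)) (expR z - (1 + z)).
  have H1 := is_deriveD (is_derive_cst (1 : R) z 1) (is_derive_id z (1 : R)).
  have H2 := is_deriveZ (2^-1 : R) (is_deriveX 2 (is_derive_id z (1 : R))).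
  have H3 := is_deriveB (is_derive_expR z) (is_deriveD H1 H2).
  have -> : (fun z : R => expR z - (1 + z + z ^+ 2 / 2)) =
      (expR - ((cst 1 + id) + 2^-1 *: (id ^+ 2))) :> (R -> R).
    by apply/funext => x; rewrite /GRing.scale /= [in LHS](mulrC _ 2^-1).
  apply: (is_derive_eq H3).
  by rewrite /GRing.scale /=; field.
have [c /andP[c0 cy]] := derivable_everywhere_MVT y0 d.
rewrite expR0 expr0n/= mul0r !addr0 subrr subr0 => E.
by rewrite -subr_ge0 E subr0 mulr_ge0// subr_ge0 expR_ge1Dx.
Qed.

Lemma powRB_natr (x : R) (n : nat) p : 0 < x -> x `^ (p - n%:R) = x `^ p / x ^+ n.
Proof.
by move=> x0; rewrite powRB ?powR_mulrn ?(ltW x0)// (gt_eqF x0) implybT.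
Qed.

(** What [near_profile] amounts to in its worst case [a = p - 1]. As
    [1 - tanh^2 = tanh^2 / sinh^2], everything is compared with
    [tanh^p / sinh^2], and the estimate becomes an upper bound of
    [sinh rho / rho]. *)
Lemma tanhR_near_origin p rho : 2 <= p -> 0 < rho <= 5 / 2 ->
  (p - 1) ^+ 2 / p ^+ 2 * (tanhR rho / rho) `^ p <=
  (p - 1) * (1 - tanhR rho `^ p) + (1 - tanhR rho `^ (p / (p - 1))).
Proof.
move=> p2 /andP[rho0 rho5]; set tau := tanhR rho.
have tau0 : 0 < tau by rewrite tanhR_gt0.
have tau1 : tau <= 1 by rewrite tanhR_le1// ltW.
have p0 : 0 < p by lra.
have pB1 : 0 < p - 1 by lra.
have s0 := sinhR_gt0 rho0.
have c0 := coshR_gt0 rho.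
set s := sinhR rho in s0.
have D : 1 - tau ^+ 2 = tau ^+ 2 / s ^+ 2.
  rewrite one_sub_tanh2 /tau /tanhR -/s; field.
  by rewrite !gt_eqF.
have S1 : rho <= 1 -> s <= 2 * rho.
  by move=> rho1; apply: sinhR_le_double; rewrite rho0.
have S2 : s ^+ 2 <= 7 * rho ^+ 2 by apply: sinhR2_le; rewrite rho0.
have T1 : tau <= rho.
  have := @tanhR_tangent _ 0 rho (lexx _) (ltW rho0).
  by rewrite {2 3}/tanhR sinhR0 mul0r expr0n/= subr0 mul1r subr0 add0r.
clearbody s tau.
have q0 : 0 < p / (p - 1) / 2 by rewrite !divr_gt0.
have taup : tau `^ p <= tau ^+ 2.
  by rewrite -powR_mulrn ?(ltW tau0)// ger_powR// tau0 tau1.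
have tauq : tau `^ (p / (p - 1)) <= 1 - p / (p - 1) / 2 * (1 - tau ^+ 2).
  rewrite [X in tau `^ X](_ : _ = 2%:R * (p / (p - 1) / 2)); last first.
    by field; rewrite gt_eqF.
  rewrite powRrM powR_mulrn ?(ltW tau0)//.
  have := @powR_bernoulli_concave _ (tau ^+ 2) (p / (p - 1) / 2).
  rewrite exprn_ge0 ?(ltW tau0)// q0/= => /(_ isT)/wrap[].
    by rewrite ler_pdivrMr// mul1r ler_pdivrMr//; lra.
have taup0 : 0 < tau `^ p by rewrite powR_gt0.
have tx0 : 0 < tau / rho by rewrite divr_gt0.
have K : (p - 1) ^+ 2 / p ^+ 2 <= (p - 1) / 4.
  rewrite ler_pdivrMr ?exprn_gt0// mulrAC ler_pdivlMr//.
  have : 0 <= (p - 1) * (p - 2) ^+ 2 by rewrite mulr_ge0 ?sqr_ge0// ltW.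
  by lra.
have K0 : 0 <= (p - 1) ^+ 2 / p ^+ 2.
  by rewrite divr_ge0// exprn_ge0// ltW.
have [rho1|rho1] := leP rho 1.
(* The first term on the right suffices, because [sinh rho <= 2 rho]. *)
- have H1 : (tau / rho) `^ p <= (tau / rho) ^+ 2.
    rewrite -powR_mulrn ?(ltW tx0)// ger_powR// tx0/=.
    by rewrite ler_pdivrMr// mul1r.
  have H2 : (tau / rho) ^+ 2 / 4 <= 1 - tau ^+ 2.
    rewrite D expr_div_n -mulrA ler_pM2l ?exprn_gt0//.
    rewrite -invfM lef_pV2 ?posrE ?mulr_gt0 ?exprn_gt0//.
    have -> : rho ^+ 2 * 4 = (2 * rho) ^+ 2 by ring.
    by rewrite lerXn2r ?nnegrE ?(ltW s0) ?S1// mulr_ge0// ltW.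
  have H3 : tau `^ (p / (p - 1)) <= 1.
    have D0 : 0 <= 1 - tau ^+ 2 by rewrite D divr_ge0 ?exprn_ge0 ?ltW.
    by apply: le_trans tauq _; rewrite gerBl mulr_ge0// ltW.
  apply: (@le_trans _ _ ((p - 1) / 4 * (tau / rho) ^+ 2)).
    by apply: ler_pM => //; exact: powR_ge0.
  have : (p - 1) * ((tau / rho) ^+ 2 / 4) <= (p - 1) * (1 - tau `^ p).
    by rewrite ler_pM2l//; lra.
  lra.
(* Both terms are used; [H5] is what the constant in [sinh^2 rho <= 7 rho^2] has to satisfy. *)
- have H1 : (tau / rho) `^ p <= tau `^ p / rho ^+ 2.
    rewrite powR_div ?(ltW tau0)// ler_pM2l//.
    rewrite lef_pV2 ?posrE ?powR_gt0 ?exprn_gt0//.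
    by rewrite -powR_mulrn ?(ltW rho0)// ler_powR// ltW.
  have H2 : p / 2 * (tau `^ p / s ^+ 2) <= 1 - tau `^ p.
    have : p / 2 * ((tau ^- 2) - 1) <= (tau ^- 2) `^ (p / 2) - 1.
      have [->|p2'] := eqVneq p 2; last first.
        apply: powR_bernoulli; first by rewrite invr_ge0 exprn_ge0 ?ltW.
        by rewrite ltr_pdivlMr// mul1r lt_neqAle eq_sym p2'.
      by rewrite divff// powRr1 ?mul1r// invr_ge0 exprn_ge0 ?ltW.
    have -> : (tau ^- 2) `^ (p / 2) = (tau `^ p)^-1.
      rewrite -powR_invn ?(ltW tau0)// -powRrM -powRN; congr (_ `^ _).
      by field.
    move=> H; have : tau `^ p * (p / 2 * (tau ^- 2 - 1)) <= tau `^ p * ((tau `^ p)^-1 - 1).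
      by rewrite ler_pM2l.
    rewrite [leRHS]mulrBr divff ?gt_eqF// mulr1; apply: le_trans.
    have -> : tau ^- 2 - 1 = (1 - tau ^+ 2) / tau ^+ 2 by field; rewrite gt_eqF.
    rewrite D le_eqVlt; apply/orP; left; apply/eqP; field.
    by rewrite !gt_eqF.
  have H3 : p / (p - 1) / 2 * (tau `^ p / s ^+ 2) <= 1 - tau `^ (p / (p - 1)).
    rewrite lerBrDl addrC -lerBrDl; apply: le_trans tauq _.
    by rewrite lerD2l lerN2 ler_pM2l// D ler_pM2r// invr_gt0 exprn_gt0.
  have H4 : 1 / rho ^+ 2 <= 7 / s ^+ 2.
    by rewrite ler_pdivlMr ?exprn_gt0// mulrAC ler_pdivrMr ?exprn_gt0// mul1r.
  have H5 : 7 / 2 * (p - 1) <= (p - 1) * p + p / (p - 1).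
    have -> : (p - 1) * p + p / (p - 1) = ((p - 1) ^+ 2 * p + p) / (p - 1).
      by field; rewrite gt_eqF.
    rewrite ler_pdivlMr//.
    have x0 : 0 <= p - 2 by lra.
    have := mulr_ge0 x0 (sqr_ge0 (p - 2 - 1 / 2)).
    have := sqr_ge0 (p - 2 - 5 / 12); lra.
  have s2 : 0 < (s ^+ 2)^-1 by rewrite invr_gt0 exprn_gt0.
  apply: (@le_trans _ _ ((p - 1) / 4 * (tau `^ p * (7 / s ^+ 2)))).
    apply: ler_pM => //; first exact: powR_ge0.
    by apply: le_trans H1 _; rewrite ler_pM2l// -[_^-1]mul1r.
  apply: (@le_trans _ _ ((p - 1) * (p / 2 * (tau `^ p / s ^+ 2)) +
     p / (p - 1) / 2 * (tau `^ p / s ^+ 2))); last first.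
    by apply: lerD => //; rewrite ler_pM2l.
  have := ler_wpM2r (ltW (mulr_gt0 taup0 s2)) H5; lra.
Qed.

(** The energy per unit of mass that is guaranteed when the mean of [r^q] is at
    most [rho^q]. *)
Definition hardy_level p a rho : R :=
  a `^ p + hardy_const p * a `^ (p - 2) / rho `^ p.

(** For the constant profile the weight, after [tanh^2 <= tanh^q], is
    [c (p a + 1) - (c + (p - 1) c^q) tanh^q r]. The tangent of [tanh] at [rho]
    and the convexity of the power [q] bound [tanh^q r] by a function affine in
    [r^q] with the value [m = tanh^q rho] at [rho]. *)
Lemma near_profile p a rho : 2 <= p -> p - 1 <= a -> 0 < rho <= 5 / 2 ->
  exists c alpha beta, [/\ 0 <= c, 0 <= beta,
    hardy_level p a rho <= alpha - beta * rho `^ (p / (p - 1)) &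
    forall r, 0 <= r -> alpha - beta * r `^ (p / (p - 1)) <=
      profile_weight p a c 1 0 r].
Proof.
move=> p2 pa rho05; have /andP[rho0 _] := rho05.
have p0 : 0 < p by lra.
have pB1 : 0 < p - 1 by lra.
have a0 : 0 < a by lra.
have := tanhR_near_origin p2 rho05.
have tau0 : 0 < tanhR rho by rewrite tanhR_gt0.
have tan r : 0 <= r -> tanhR r <= tanhR rho + (1 - tanhR rho ^+ 2) * (r - rho).
  by move=> r0; apply: tanhR_tangent => //; exact: ltW.
have th0 := tan 0 (lexx _); rewrite {1}/tanhR sinhR0 mul0r in th0.
have tau1 : 0 <= 1 - tanhR rho ^+ 2.
  by rewrite one_sub_tanh2 invr_ge0 exprn_ge0// ltW// coshR_gt0.
set tau := tanhR rho in tau0 tan th0 tau1 *.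
set q := p / (p - 1).
have q1 : 1 < q by rewrite /q ltr_pdivlMr// mul1r; lra.
have q2 : q <= 2 by rewrite /q ler_pdivrMr//; lra.
have q0 : 0 < q by lra.
set m := tau `^ q => Hkey.
have m0 : 0 < m by rewrite powR_gt0.
(* This value maximizes [c p a - (p - 1) c^q m], the main part of the weight at
   [rho]. *)
pose c := (a / m) `^ (p - 1).
have am0 : 0 < a / m by rewrite divr_gt0.
have c0 : 0 < c by rewrite powR_gt0.
have cq : c `^ q = c * a / m.
  rewrite /c -powRrM /q mulrCA divff ?gt_eqF// mulr1.
  by rewrite -[RHS]mulrA [RHS]mulrC mulr_powRB1// ltW.
(* The tangent of [tanh] at [rho] is [tau (1 - th + th r / rho)]; it is
   nonnegative at [0], so [th <= 1]. *)
pose th := (1 - tau ^+ 2) * rho / tau.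
have thge0 : 0 <= th.
  by apply: divr_ge0; [apply: mulr_ge0 => //|]; exact: ltW.
have thle1 : th <= 1 by rewrite /th ler_pdivrMr// mul1r; lra.
have rhoq : 0 < rho `^ q by rewrite powR_gt0.
pose coef := c + (p - 1) * c `^ q.
have coef0 : 0 <= coef.
  by apply: addr_ge0; [|apply: mulr_ge0; last exact: powR_ge0]; exact: ltW.
exists c, (c * (p * a + 1) - coef * m * (1 - th)), (coef * m * th / rho `^ q).
split => //.
- exact: ltW.
- by apply: divr_ge0; [apply: mulr_ge0 => //; apply: mulr_ge0 => //|]; exact: ltW.
- rewrite divfK ?gt_eqF//.
  have -> : c * (p * a + 1) - coef * m * (1 - th) - coef * m * th =
    c * (p * a + 1) - coef * m by ring.
  rewrite /coef cq.
  have -> : c * (p * a + 1) - (c + (p - 1) * (c * a / m)) * m = c * (a + 1 - m).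
    by field; rewrite gt_eqF.
  have cE : c = a `^ (p - 2) * a / tau `^ p.
    rewrite /c powR_div ?(ltW a0)//.
    have -> : m `^ (p - 1) = tau `^ p.
      by rewrite /m -powRrM /q divfK// gt_eqF.
    by rewrite (powRB_natr 2)// (powRB_natr 1)//; field; rewrite !gt_eqF// powR_gt0.
  have apE : a `^ p = a `^ (p - 2) * a ^+ 2.
    by rewrite (powRB_natr 2)// divfK// gt_eqF// exprn_gt0.
  rewrite /hardy_level apE cE.
  have taup : 0 < tau `^ p by rewrite powR_gt0.
  have rhop : 0 < rho `^ p by rewrite powR_gt0.
  have ap : 0 < a `^ (p - 2) by rewrite powR_gt0.
  have -> : a `^ (p - 2) * a ^+ 2 + hardy_const p * a `^ (p - 2) / rho `^ p =
    a `^ (p - 2) / tau `^ p * (a ^+ 2 * tau `^ p + hardy_const p * (tau `^ p / rho `^ p)).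
    by field; rewrite !gt_eqF.
  have -> : a `^ (p - 2) * a / tau `^ p * (a + 1 - m) =
    a `^ (p - 2) / tau `^ p * (a * (a + 1 - m)) by ring.
  rewrite ler_pM2l ?divr_gt0//.
  rewrite -powR_div ?(ltW tau0)//.
  have pow1 (x : R) : 0 < x -> 0 <= 1 - tau `^ x.
    have E : 1 `^ x = 1 :> R by rewrite powR1.
    move=> x0; rewrite subr_ge0 -[leRHS]E.
    by rewrite ge0_ler_powR ?nnegrE ?(ltW x0) ?(ltW tau0)// tanhR_le1// ltW.
  have taup1 := pow1 _ p0.
  have m1 : 0 <= 1 - m := pow1 _ q0.
  have H1 : hardy_const p * (tau / rho) `^ p <=
      (p - 1) * ((p - 1) * (1 - tau `^ p) + (1 - m)).
    have -> : hardy_const p = (p - 1) * ((p - 1) ^+ 2 / p ^+ 2).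
      by rewrite /hardy_const exprS mulrA.
    by rewrite -mulrA ler_pM2l.
  have H2 : (p - 1) * (1 - m) <= a * (1 - m) by rewrite ler_wpM2r.
  have H3 : (p - 1) ^+ 2 * (1 - tau `^ p) <= a ^+ 2 * (1 - tau `^ p).
    by rewrite ler_wpM2r// lerXn2r// nnegrE ltW.
  lra.
- move=> r r0; rewrite /profile_weight.
  have T0 := tanhR_ge0 r0; have T1 := tanhR_le1 r0.
  have Tq : tanhR r `^ q <= m * (1 - th + th * (r `^ q / rho `^ q)).
    rewrite -powR_div//.
    have H : tanhR r <= tau * (1 - th + th * (r / rho)).
      apply: le_trans (tan _ r0) _; rewrite le_eqVlt; apply/orP; left; apply/eqP.
      by rewrite /th; field; rewrite !gt_eqF.
    have rr0 : 0 <= r / rho by rewrite divr_ge0// ltW.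
    have th1' : 0 <= 1 - th by rewrite subr_ge0.
    have y0 : 0 <= 1 - th + th * (r / rho) by apply: addr_ge0 => //; apply: mulr_ge0.
    apply: (@le_trans _ _ ((tau * (1 - th + th * (r / rho))) `^ q)).
      apply: ge0_ler_powR; rewrite ?nnegrE //; first exact: ltW.
      by apply: mulr_ge0 => //; exact: ltW.
    rewrite powRM ?(ltW tau0)// ler_pM2l//.
    by apply: powR_convex_one => //; rewrite thge0.
  have T2 : tanhR r ^+ 2 <= tanhR r `^ q.
    clear - T0 T1 q0 q2; rewrite -powR_mulrn; last exact: T0.
    move: T0; rewrite le_eqVlt => /predU1P[<-|T0].
      by rewrite !powR0 ?gt_eqF.
    by rewrite ger_powR ?T0.
  rewrite -/q mulr1 sub0r mulN1r mulr1 powRM ?(ltW c0)//.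
  have : coef * tanhR r `^ q <= coef * (m * (1 - th + th * (r `^ q / rho `^ q))).
    by rewrite ler_wpM2l.
  have : c * tanhR r ^+ 2 <= c * tanhR r `^ q by rewrite ler_pM2l.
  rewrite /coef.
  have -> : (c + (p - 1) * c `^ q) * m * th / rho `^ q * r `^ q =
    (c + (p - 1) * c `^ q) * (m * (th * (r `^ q / rho `^ q))) by ring.
  lra.
Qed.

End near_profile.

(** * Fields adapted to large radii *)
Section far_profile.
Context {R : realType}.
Implicit Types a p r rho t L : R.

(** The logarithmic derivative of [t / sqrt (t^2 + L^2)], which is positive and
    concave on the half-line. *)
Definition far_slope L t : R := t^-1 - t / (t ^+ 2 + L ^+ 2).
Definition far_dslope L t : R :=
  - (t ^- 2) - (L ^+ 2 - t ^+ 2) / (t ^+ 2 + L ^+ 2) ^+ 2.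

Lemma sqrD_gt0 L t : 0 < t -> 0 < t ^+ 2 + L ^+ 2.
Proof. by move=> t0; rewrite ltr_pwDl ?exprn_gt0 ?sqr_ge0. Qed.

Lemma is_derive_far_slope L t : 0 < t -> is_derive t 1 (far_slope L) (far_dslope L t).
Proof.
move=> t0; have q0 := sqrD_gt0 L t0.
have H1 := is_deriveV (lt0r_neq0 t0) (is_derive_id t (1 : R)).
have H2 := is_deriveD (is_deriveX 2 (is_derive_id t (1 : R))) (is_derive_cst (L ^+ 2) t (1 : R)).
have H3 := @is_deriveV _ ((id : R -> R) ^+ 2 + cst (L ^+ 2)) t _ _ (lt0r_neq0 q0) H2.
have H4 := is_deriveM (is_derive_id t (1 : R)) H3.
have -> : far_slope L = ((fun y => (id y)^-1) -
  id * (fun y => (((id : R -> R) ^+ 2 + cst (L ^+ 2)) y)^-1)) by [].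
apply: (is_derive_eq (is_deriveB H1 H4)).
have E : ((id : R -> R) ^+ 2 + cst (L ^+ 2)) t = t ^+ 2 + L ^+ 2 by [].
rewrite /GRing.scale/= E /far_dslope; field.
by rewrite !gt_eqF.
Qed.

(** [- S' - S^2] equals [3 L^2 / (t^2 + L^2)^2], and the left-hand side is its
    tangent at [t = L]: the difference is a multiple of [(t / L - 1)^2]. *)
Lemma far_slope_riccati L t : 0 < t -> 0 < L ->
  3 / (4 * L ^+ 2) * (3 - 2 * (t / L)) <= - far_dslope L t - far_slope L t ^+ 2.
Proof.
move=> t0 L0; have q0 := sqrD_gt0 L t0.
have -> : - far_dslope L t - far_slope L t ^+ 2 = 3 * L ^+ 2 / (t ^+ 2 + L ^+ 2) ^+ 2.
  by rewrite /far_dslope /far_slope; field; rewrite !gt_eqF.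
set x := t / L.
have x0 : 0 < x by rewrite divr_gt0.
have -> : t = x * L by rewrite /x divfK// gt_eqF.
have x1 : 0 < x ^+ 2 + 1 by rewrite ltr_wpDl ?sqr_ge0.
have -> : 3 * L ^+ 2 / ((x * L) ^+ 2 + L ^+ 2) ^+ 2 =
   3 / (4 * L ^+ 2) * (4 / (x ^+ 2 + 1) ^+ 2).
  field; rewrite !gt_eqF//.
  by rewrite -[X in _ + X]mul1r exprMn -mulrDl mulr_gt0 ?exprn_gt0.
rewrite ler_pM2l; last by rewrite divr_gt0// mulr_gt0// exprn_gt0.
rewrite ler_pdivlMr ?exprn_gt0// -subr_ge0.
have -> : 4 - (3 - 2 * x) * (x ^+ 2 + 1) ^+ 2 =
  (x - 1) ^+ 2 * (2 * x ^+ 3 + x ^+ 2 + 4 * x + 1) by ring.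
apply: mulr_ge0; first exact: sqr_ge0.
by have := exprn_ge0 3 (ltW x0); have := sqr_ge0 x; lra.
Qed.

(** The bracket is the factor of [1 - tanh^2 r] in the weight ([far_weight]). Its
    minorant is positive for [t > 3/2], so the region around the pole gives an
    additional gain, which pays for replacing [log cosh r] by [r]. *)
Lemma far_slope_bracket a L t : 1 <= a -> 1 <= t ->
  2 - 3 / t <= (a - far_slope L t) + (a - far_slope L t) ^+ 2 + far_dslope L t.
Proof.
move=> a1 t1; have t0 : 0 < t by lra.
have q0 := sqrD_gt0 L t0.
set i := t^-1; set k := (t ^+ 2 + L ^+ 2)^-1.
have i0 : 0 < i by rewrite invr_gt0.
have k0 : 0 < k by rewrite invr_gt0.
have i1 : i <= 1 by rewrite invf_le1.
have e0 : 0 < t * k by rewrite mulr_gt0.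
have SE : far_slope L t = i - t * k by [].
have S1 : far_slope L t <= 1 by rewrite SE; lra.
have DE : far_dslope L t = - i ^+ 2 - k + 2 * (t * k) ^+ 2.
  by rewrite /far_dslope /i /k; field; rewrite !gt_eqF.
have H : (1 - far_slope L t) + (1 - far_slope L t) ^+ 2 <=
         (a - far_slope L t) + (a - far_slope L t) ^+ 2.
  apply: lerD; first by lra.
  by rewrite lerXn2r// ?nnegrE; lra.
apply: (@le_trans _ _ ((1 - far_slope L t) + (1 - far_slope L t) ^+ 2 +
  far_dslope L t)); last by lra.
rewrite DE SE -subr_ge0.
have kE : k = (t * k) * i by rewrite /i; field; rewrite gt_eqF.
have -> : 1 - (i - t * k) + (1 - (i - t * k)) ^+ 2 + (- i ^+ 2 - k + 2 * (t * k) ^+ 2)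
   - (2 - 3 * i) = (t * k) * (3 - 2 * i) + 3 * (t * k) ^+ 2 - k by ring.
rewrite [X in _ - X]kE.
have -> : t * k * (3 - 2 * i) + 3 * (t * k) ^+ 2 - t * k * i =
   3 * (t * k) * (1 - i) + 3 * (t * k) ^+ 2 by ring.
apply: addr_ge0; last by rewrite mulr_ge0 ?sqr_ge0.
by apply: mulr_ge0; [rewrite mulr_ge0// ltW|rewrite subr_ge0].
Qed.

(** [log cosh r] is [r - log 2 + log (1 + exp (- 2 r))], where [log 2 >= 2/3] and
    the last term is at most [exp (- 2 r) <= 1 / cosh^2 r]. *)
Lemma ln_coshR_le r : 0 <= r -> ln (coshR r) <= r - 2 / 3 + (1 - tanhR r ^+ 2).
Proof.
move=> r0; have c0 := coshR_gt0 r; rewrite one_sub_tanh2.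
have e1 : 0 < expR (- r) by exact: expR_gt0.
have cE : coshR r <= expR r.
  have : expR (- r) <= expR r by rewrite ler_expR; lra.
  by rewrite /coshR; lra.
have eE : expR (- r) ^+ 2 <= (coshR r ^+ 2)^-1.
  rewrite expRN exprVn lef_pV2 ?posrE ?exprn_gt0 ?expR_gt0//.
  by rewrite lerXn2r// nnegrE ltW// expR_gt0.
rewrite -ler_expR lnK ?posrE//.
apply: (@le_trans _ _ (expR (r - 2 / 3) * expR (expR (- r) ^+ 2))); last first.
  by rewrite -expRD ler_expR lerD2l.
have -> : coshR r = expR r / 2 * (1 + expR (- r) ^+ 2).
  by rewrite /coshR expRN; field; rewrite gt_eqF// expR_gt0.
apply: ler_pM; rewrite ?divr_ge0 ?expR_ge0 ?addr_ge0 ?exprn_ge0 ?expR_ge0 ?expR_ge1Dx//.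
rewrite expRB ler_pM2l ?expR_gt0// lef_pV2 ?posrE ?expR_gt0//.
exact: expR_23_le2.
Qed.

(** For [rho >= 5/2] one has [rho + 7/8 <= 27/20 rho] and [rho >= exp (7/8)], so
    that [rho^(p-2)] outgrows [(p - 1)^3 / p^2] by the quadratic minorant of
    [exp]. *)
Lemma hardy_const_far p rho : 2 <= p -> 5 / 2 <= rho ->
  hardy_const p / rho `^ p <= 3 / (4 * (rho + 7 / 8) ^+ 2).
Proof.
move=> p2 rho5; have rho0 : 0 < rho by lra.
have rhop : 0 < rho `^ p by rewrite powR_gt0.
have L0 : 0 < rho + 7 / 8 by lra.
set x := p - 2; have x0 : 0 <= x by rewrite /x; lra.
have H1 : 1 + 7 / 8 * x + (7 / 8 * x) ^+ 2 / 2 <= rho `^ x.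
  apply: (@le_trans _ _ (expR (7 / 8 * x))).
    by apply: expR_ge_quadratic; rewrite mulr_ge0.
  rewrite expRM ge0_ler_powR ?nnegrE ?expR_ge0 ?(ltW rho0)//.
  by apply: le_trans expR_78_le _.
have H2 : (rho + 7 / 8) ^+ 2 <= (27 / 20) ^+ 2 * rho ^+ 2.
  by rewrite -exprMn lerXn2r ?nnegrE; lra.
have E : rho `^ p = rho `^ x * rho ^+ 2.
  by rewrite /x (powRB_natr 2)// divfK// gt_eqF// exprn_gt0.
have p0 : 0 < p by lra.
rewrite ler_pdivrMr// mulrAC ler_pdivlMr; last by rewrite mulr_gt0// exprn_gt0.
have K0 : 0 <= hardy_const p by rewrite divr_ge0 ?exprn_ge0; lra.
rewrite /hardy_const in K0 *.
apply: (@le_trans _ _ (hardy_const p * (4 * ((27 / 20) ^+ 2 * rho ^+ 2)))).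
  by rewrite ler_wpM2l// ler_pM2l.
rewrite E.
have -> : hardy_const p * (4 * ((27 / 20) ^+ 2 * rho ^+ 2)) =
  hardy_const p * (4 * (27 / 20) ^+ 2) * rho ^+ 2 by ring.
rewrite [leRHS]mulrA ler_pM2r ?exprn_gt0//.
apply: (@le_trans _ _ (3 * (1 + 7 / 8 * x + (7 / 8 * x) ^+ 2 / 2))); last first.
  by rewrite ler_pM2l.
have pE : p = x + 2 by rewrite /x; lra.
rewrite /hardy_const mulrAC ler_pdivrMr ?exprn_gt0// pE.
have x3 : 0 <= x * (x - 1) ^+ 2 by rewrite mulr_ge0 ?sqr_ge0.
have x4 : 0 <= (x ^+ 2 - 7 / 4) ^+ 2 by rewrite sqr_ge0.
have xx : 0 <= x ^+ 2 by rewrite sqr_ge0.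
have xx3 : 0 <= x ^+ 3 by rewrite exprn_ge0.
nra.
Qed.

End far_profile.

Section radial_profile.
Context {R : realType}.
Implicit Types a p r rho t L : R.

(** The shift [37/24 = 2/3 + 7/8] makes up for the [2/3] of [ln_coshR_le], so
    that the argument of the slope is [r + 7/8] up to [1 / cosh^2 r], and exceeds
    the threshold [3/2] of [far_slope_bracket]. *)
Definition far_profile a L t : R := 1 - far_slope L (t + 37 / 24) / a.
Definition far_dprofile a L t : R := - far_dslope L (t + 37 / 24) / a.

Lemma is_derive_far_profile a L t : 0 <= t ->
  is_derive t 1 (far_profile a L) (far_dprofile a L t).
Proof.
move=> t0; have td : 0 < t + 37 / 24 by lra.
have H1 := is_deriveD (is_derive_id t (1 : R)) (is_derive_cst (37 / 24 : R) t (1 : R)).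
have H2 := @is_derive1_comp _ (far_slope L) ((id : R -> R) + cst (37 / 24 : R)) t _ _
  (is_derive_far_slope L td) H1.
have H3 := is_deriveB (is_derive_cst (1 : R) t (1 : R)) (is_deriveZ a^-1 H2).
have -> : far_profile a L = cst 1 - a^-1 *: (far_slope L \o ((id : R -> R) + cst (37 / 24 : R))).
  by apply/funext => x; rewrite /far_profile /GRing.scale/= mulrC.
apply: (is_derive_eq H3).
by rewrite /GRing.scale/= /far_dprofile sub0r addr0 mulr1 mulrC mulNr.
Qed.

Lemma continuous_far_dprofile a L t : 0 <= t -> {for t, continuous (far_dprofile a L)}.
Proof.
move=> t0; have td : 0 < t + 37 / 24 by lra.
have q0 := sqrD_gt0 L td.
have sq (f : R -> R) : {for t, continuous f} ->
    {for t, continuous (fun y => f y ^+ 2)}.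
  by move=> cf; exact: (continuous_comp cf (@exprn_continuous _ 2 _)).
have cs : {for t, continuous (fun y : R => y + 37 / 24)}.
  by apply: cvgD; [exact: cvg_id|exact: cvg_cst].
have c2 : {for t, continuous (fun y : R => (y + 37 / 24) ^+ 2)}.
  exact: sq.
apply: cvgM; last exact: cvg_cst.
apply: cvgN; apply: cvgB.
  by apply: cvgN; apply: cvgV => //; rewrite gt_eqF// exprn_gt0.
apply: cvgM; first by apply: cvgB => //; exact: cvg_cst.
apply: cvgV; first by rewrite gt_eqF// exprn_gt0.
by apply: sq; apply: cvgD => //; exact: cvg_cst.
Qed.

Lemma far_profile_ge0 a L t : 1 <= a -> 0 <= t -> 0 <= far_profile a L t.
Proof.
move=> a1 t0; have td : 1 <= t + 37 / 24 by lra.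
rewrite subr_ge0 ler_pdivrMr; last lra.
rewrite mul1r /far_slope; apply: le_trans a1.
have : (t + 37 / 24)^-1 <= 1 by rewrite invf_le1//; lra.
have : 0 <= (t + 37 / 24) / ((t + 37 / 24) ^+ 2 + L ^+ 2).
  by rewrite divr_ge0 ?addr_ge0 ?sqr_ge0//; lra.
lra.
Qed.

(** Once [powR_conj_quadratic] has replaced the power [q], the weight is at least
    [a^p + a^(p-2) (- S' - S^2 + (1 - tanh^2 r) b)], with [b] the bracket of
    [far_slope_bracket]. The term [- S' - S^2] is bounded by its tangent, and [b]
    dominates the error made there in passing from [log cosh r] to [r]. *)
Lemma far_weight p a L r : 2 <= p -> p - 1 <= a -> 27 / 8 <= L -> 0 <= r ->
  a `^ p + a `^ (p - 2) * (3 / (4 * L ^+ 2) * (3 - 2 * ((r + 7 / 8) / L))) <=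
  profile_weight p a (a `^ (p - 1)) (far_profile a L (ln (coshR r)))
    (far_dprofile a L (ln (coshR r))) r.
Proof.
move=> p2 pa L3 r0.
have p0 : 0 < p by lra.
have pB1 : 0 < p - 1 by lra.
have a1 : 1 <= a by lra.
have a0 : 0 < a by lra.
have L0 : 0 < L by lra.
have t0 : 0 <= ln (coshR r) by rewrite ln_ge0// coshR_ge1.
have tle := ln_coshR_le r0.
set t := ln (coshR r) in t0 tle *.
have td1 : 37 / 24 <= t + 37 / 24 by lra.
have td : 0 < t + 37 / 24 by lra.
have v0 := far_profile_ge0 L a1 t0.
have T0 := tanhR_ge0 r0; have T1 := tanhR_le1 r0.
have riccati := far_slope_riccati td L0.
have bracket := @far_slope_bracket _ a L (t + 37 / 24) a1 _.
have {}bracket := bracket ltac:(lra).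
rewrite /profile_weight.
set v := far_profile a L t in v0 *.
have vE : v = 1 - far_slope L (t + 37 / 24) / a by [].
rewrite /far_dprofile.
set S := far_slope L (t + 37 / 24) in riccati bracket vE.
set dS := far_dslope L (t + 37 / 24) in riccati bracket *.
set T := tanhR r in tle T0 T1 *.
have ap2 : 0 < a `^ (p - 2) by rewrite powR_gt0.
have cE : a `^ (p - 1) = a `^ (p - 2) * a.
  by rewrite (powRB_natr 2)// (powRB_natr 1)//; field; rewrite gt_eqF.
have apE : a `^ p = a `^ (p - 2) * a ^+ 2.
  by rewrite (powRB_natr 2)// divfK// gt_eqF// exprn_gt0.
have cq : (a `^ (p - 1)) `^ (p / (p - 1)) = a `^ (p - 2) * a ^+ 2.
  by rewrite -powRrM mulrCA divff ?gt_eqF// mulr1 apE.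
have w0 : 0 <= v * T by rewrite mulr_ge0.
rewrite -[_ * v * T]mulrA (@powRM _ _ (v * T)) ?powR_ge0// cq.
have quad := powR_conj_quadratic p2 w0.
have D0 : 0 <= 1 - T ^+ 2 by rewrite subr_ge0 -(expr1n _ 2) lerXn2r ?nnegrE.
have tb : 3 / (4 * L ^+ 2) * (3 - 2 * ((r + 7 / 8) / L)) <=
    3 / (4 * L ^+ 2) * (3 - 2 * ((t + 37 / 24) / L)) + (1 - T ^+ 2) * (3 / (2 * L ^+ 3)).
  have -> : 3 / (4 * L ^+ 2) * (3 - 2 * ((t + 37 / 24) / L)) + (1 - T ^+ 2) * (3 / (2 * L ^+ 3)) =
    3 / (4 * L ^+ 2) * (3 - 2 * ((t + 37 / 24 - (1 - T ^+ 2)) / L)).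
    by field; rewrite gt_eqF.
  rewrite ler_wpM2l//; first by rewrite divr_ge0// mulr_ge0// sqr_ge0.
  rewrite lerD2l lerN2 ler_pM2l// ler_pM2r ?invr_gt0//; lra.
have bb : 3 / (2 * L ^+ 3) <= (a - S) + (a - S) ^+ 2 + dS.
  apply: le_trans bracket.
  have H1 : 3 / (t + 37 / 24) <= 72 / 37.
    rewrite ler_pdivrMr//; lra.
  have H2 : 3 / (2 * L ^+ 3) <= 1 / 25.
    rewrite ler_pdivrMr ?mulr_gt0 ?exprn_gt0//.
    have : (27 / 8) ^+ 3 <= L ^+ 3 by rewrite lerXn2r ?nnegrE ?(ltW L0).
    lra.
  lra.
have bD : (1 - T ^+ 2) * (3 / (2 * L ^+ 3)) <= (1 - T ^+ 2) * ((a - S) + (a - S) ^+ 2 + dS).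
  by rewrite ler_wpM2l.
have wv : (p - 2) * (v * T) <= (p - 2) * v.
  by rewrite ler_wpM2l ?ler_piMr//; lra.
(* An identity: this is where the dimension [p a + 1] and the gap [a^p] fit. *)
have key : a ^+ 2 + (- dS - S ^+ 2 + (1 - T ^+ 2) * ((a - S) + (a - S) ^+ 2 + dS)) <=
   a * ((- dS / a - v) * T ^+ 2 + (p * a + 1) * v) - a ^+ 2 * ((p - 2) * v + (v * T) ^+ 2).
  rewrite le_eqVlt; apply/orP; left; apply/eqP; rewrite vE; field.
  by rewrite gt_eqF.
have : a ^+ 2 * ((p - 1) * (v * T) `^ (p / (p - 1))) <= a ^+ 2 * ((p - 2) * v + (v * T) ^+ 2).
  by rewrite ler_pM2l ?exprn_gt0//; lra.
move=> quad'.
rewrite apE cE.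
have -> : a `^ (p - 2) * a * ((- dS / a - v) * T ^+ 2 + (p * a + 1) * v) -
  (p - 1) * (a `^ (p - 2) * a ^+ 2 * (v * T) `^ (p / (p - 1))) =
  a `^ (p - 2) * (a * ((- dS / a - v) * T ^+ 2 + (p * a + 1) * v) -
    a ^+ 2 * ((p - 1) * (v * T) `^ (p / (p - 1)))) by ring.
rewrite -mulrDr ler_pM2l//.
move: key quad' bD tb riccati.
set X1 := 3 / (4 * L ^+ 2) * _; set X2 := 3 / (4 * L ^+ 2) * _.
set X3 := a * _; set X4 := a ^+ 2 * _; set X5 := a ^+ 2 * _.
set X6 := _ * (3 / (2 * L ^+ 3)); set X7 := _ * (a - S + _ + _).
clear; lra.
Qed.

(** For large [rho] the minorant of [far_weight] is affine in [r]; Bernoulli's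
    inequality for [(r / rho)^q] turns it into one that is affine in [r^q] and
    has the same value and slope at [rho]. *)
Lemma radial_profile p a rho : 2 <= p -> p - 1 <= a -> 0 < rho ->
  exists c (v dv : R -> R) alpha beta,
  [/\ 0 <= c /\ 0 <= beta,
      forall t, 0 <= t -> is_derive t 1 v (dv t),
      forall t, 0 <= t -> {for t, continuous dv} /\ 0 <= v t,
      hardy_level p a rho <= alpha - beta * rho `^ (p / (p - 1)) &
      forall r, 0 <= r -> alpha - beta * r `^ (p / (p - 1)) <=
        profile_weight p a c (v (ln (coshR r))) (dv (ln (coshR r))) r].
Proof.
move=> p2 pa rho0; have [rho5|rho5] := leP rho (5 / 2).
  have [|c [alpha [beta [c0 b0 lev wei]]]] := @near_profile _ p a rho p2 pa _.
    by rewrite rho0.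
  exists c, (cst 1), (cst 0), alpha, beta; split => //.
  - by move=> t _; apply: is_derive_cst.
  - by move=> t _; split; [exact: cvg_cst|exact: ler01].
(* With this scale the tangent of [far_slope_riccati] is taken at [r = rho]. *)
pose L := rho + 7 / 8.
have L0 : 0 < L by rewrite /L; lra.
have p0 : 0 < p by lra.
have pB1 : 0 < p - 1 by lra.
have a1 : 1 <= a by lra.
have a0 : 0 < a by lra.
have ap2 : 0 < a `^ (p - 2) by rewrite powR_gt0.
pose q := p / (p - 1).
have q1 : 1 < q by rewrite /q ltr_pdivlMr// mul1r; lra.
have q0 : 0 < q by lra.
have rhoq : 0 < rho `^ q by rewrite powR_gt0.
pose b := a `^ (p - 2) * (3 / (2 * L ^+ 3)).
have b0 : 0 < b by rewrite /b mulr_gt0// divr_gt0// mulr_gt0// exprn_gt0.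
exists (a `^ (p - 1)), (far_profile a L), (far_dprofile a L).
exists (a `^ p + a `^ (p - 2) * (3 / (4 * L ^+ 2) * (3 - 2 * ((rho / p + 7 / 8) / L)))).
exists (b * rho / q / rho `^ q).
split.
- split; first exact: powR_ge0.
  by apply: divr_ge0; [apply: divr_ge0; [apply: mulr_ge0|]|]; exact: ltW.
- by move=> t t0; exact: is_derive_far_profile.
- by move=> t t0; split; [exact: continuous_far_dprofile|exact: far_profile_ge0].
- rewrite -/q divfK ?gt_eqF// /hardy_level.
  have -> : a `^ p + a `^ (p - 2) * (3 / (4 * L ^+ 2) * (3 - 2 * ((rho / p + 7 / 8) / L))) -
      b * rho / q = a `^ p + a `^ (p - 2) * (3 / (4 * L ^+ 2)).
    by rewrite /b /q /L; field; rewrite !gt_eqF//; lra.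
  rewrite lerD2l mulrAC mulrC ler_pM2l//.
  by apply: hardy_const_far => //; exact: ltW.
- move=> r r0; apply: le_trans (@far_weight p a L r p2 pa _ r0); last by rewrite /L; lra.
  have -> : b * rho / q / rho `^ q * r `^ (p / (p - 1)) = b * rho / q * (r / rho) `^ q.
    by rewrite powR_div// -/q; ring.
  have := @powR_bernoulli _ (r / rho) q; rewrite divr_ge0 ?(ltW rho0)// => /(_ isT q1) H.
  have : b * rho / q * (q * (r / rho - 1)) <= b * rho / q * ((r / rho) `^ q - 1).
    rewrite ler_wpM2l//; apply: divr_ge0; [apply: mulr_ge0|]; exact: ltW.
  set Y := (r / rho) `^ q.
  have -> : b * rho / q * (q * (r / rho - 1)) = b * (r - rho).
    by field; rewrite !gt_eqF.
  have -> : a `^ p + a `^ (p - 2) * (3 / (4 * L ^+ 2) * (3 - 2 * ((rho / p + 7 / 8) / L))) =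
    a `^ p + a `^ (p - 2) * (3 / (4 * L ^+ 2) * (3 - 2 * ((r + 7 / 8) / L))) +
      b * (r - rho) + b * rho / q.
    by rewrite /b /q; field; rewrite !gt_eqF.
  clear; lra.
Qed.

End radial_profile.

(** * Integration of compactly supported continuous functions *)
Section measurable_continuous.
Context {R : realType} {n : nat}.
Local Notation TR := (n.+1.-tuple (measurableTypeR R)).

Definition grid_coord (k : nat) (x : R) : int := Num.floor (k.+1%:R * x).

Lemma measurable_grid_coord k (m : int) :
  measurable ([set x | grid_coord k x = m] : set (measurableTypeR R)).
Proof.
rewrite (_ : [set _ | _] = `[m%:~R / k.+1%:R, (m + 1)%:~R / k.+1%:R[%classic).
  exact: measurable_itv.
apply/seteqP; split => x; rewrite /grid_coord /= in_itv/=.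
  move=> <-; rewrite ler_pdivrMr ?ltr0n// ltr_pdivlMr ?ltr0n// mulrC.
  exact: real_floor_itv (num_real _).
rewrite ler_pdivrMr ?ltr0n// ltr_pdivlMr ?ltr0n// mulrC.
exact: floor_def.
Qed.

Definition grid_point k (m : n.+1.-tuple int) : 'rV[R]_n.+1 :=
  \row_i ((tnth m i)%:~R / k.+1%:R).

Definition grid_cell k (t : TR) : n.+1.-tuple int :=
  [tuple grid_coord k (tnth t i) | i < n.+1].

Lemma measurable_grid k (f : 'rV[R]_n.+1 -> R) :
  measurable_fun setT (fun t : TR => f (grid_point k (grid_cell k t))).
Proof.
move=> _ Y mY; rewrite setTI.
pose F (m : n.+1.-tuple int) : set TR := [set t | Y (f (grid_point k m))] `&`
  \bigcap_(i in [set: 'I_n.+1]) [set t | grid_coord k (tnth t i) = tnth m i].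
rewrite (_ : _ @^-1` _ = \bigcup_m F m); last first.
  apply/seteqP; split => [t Yt|t [m _ [Ym Hm]]].
    exists (grid_cell k t) => //; split => // i _ /=.
    by rewrite tnth_mktuple.
  rewrite /preimage/= (_ : grid_cell k t = m)//.
  by apply: eq_from_tnth => i; rewrite tnth_mktuple; exact: Hm.
apply: countable_bigcupT_measurable; first exact: countableP.
move=> m; apply: measurableI.
  have [H|H] := pselect (Y (f (grid_point k m))).
    by rewrite (_ : [set _ | _] = setT)//; apply/seteqP; split.
  by rewrite (_ : [set _ | _] = set0)//; apply/seteqP; split.
apply: fin_bigcap_measurable; first exact: finite_finset.
move=> i _; rewrite -[X in measurable X]setTI.
apply: (@measurable_tnth _ (measurableTypeR R) n.+1 i measurableT
  [set x | grid_coord k x = tnth m i]).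
exact: measurable_grid_coord.
Qed.

Lemma cvg_grid (t : TR) :
  grid_point k (grid_cell k t) @[k --> \oo] --> row_of_tuple t.
Proof.
apply/cvg_ballP => e e0; near=> k; split=> // i j.
rewrite /ball/= !mxE tnth_mktuple /grid_coord.
set x := tnth t j.
have /andP[] := real_floor_itv (num_real (k.+1%:R * x : R)).
set m := Num.floor _ => H1; rewrite intrD => H2.
have k0 : (0 : R) < k.+1%:R by rewrite ltr0n.
have E : x - m%:~R / k.+1%:R = (k.+1%:R * x - m%:~R) / k.+1%:R.
  by rewrite mulrBl mulrAC mulfV ?gt_eqF// mul1r.
rewrite E ger0_norm; last by rewrite divr_ge0 ?subr_ge0// ltW.
apply: (@lt_trans _ _ (k.+1%:R^-1)).
  by rewrite -[ltRHS]mul1r ltr_pM2r ?invr_gt0// ltrBlDl.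
near: k; exact: near_infty_natSinv_lt (PosNum e0).
Unshelve. all: by end_near. Qed.

(** The sigma-algebra on tuples is the product one. A continuous function is
    measurable for it as the limit of its samples on finer and finer grids, each
    of which has countably many level sets that are finite intersections of
    conditions on single coordinates. *)
Lemma measurable_continuous (f : 'rV[R]_n.+1 -> R) : continuous f ->
  measurable_fun setT (f \o row_of_tuple : TR -> measurableTypeR R).
Proof.
move=> cf; apply: (@measurable_fun_cvg _ _ _ _
  (fun k (t : TR) => f (grid_point k (grid_cell k t)))).
  by move=> k; exact: measurable_grid.
by move=> t _; exact: (cvg_comp _ _ (@cvg_grid t) (cf (row_of_tuple t))).
Qed.

End measurable_continuous.

Section boxes.
Context {R : realType}.
Local Notation mu := (@lebesgue_measure R).
Local Notation TR n := (n.-tuple (measurableTypeR R)).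

Definition box n (M : R) : set (TR n) := [set t | forall i, `|tnth t i| <= M].
Arguments box : clear implicits.

Lemma measurable_box n M : measurable (box n M).
Proof.
rewrite (_ : box n M = \bigcap_(i in [set: 'I_n]) [set t | `|tnth t i| <= M]); last first.
  by apply/seteqP; split => t H i => //=; exact: H.
apply: fin_bigcap_measurable; first exact: finite_finset.
move=> i _; rewrite -[X in measurable X]setTI.
apply: (@measurable_tnth _ (measurableTypeR R) n i measurableT [set x | `|x| <= M]).
rewrite (_ : [set x : measurableTypeR R | _] = `[- M, M]%classic); first exact: measurable_itv.
by apply/seteqP; split => x; rewrite /= in_itv/= ler_norml.
Qed.

Lemma lebesgue_tuple_box n M : (lebesgue_tuple R n (box n M) < +oo)%E.
Proof.
elim: n => [|n IH] /=; first by rewrite diracE ltry.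
rewrite /product_cons /pushforward.
have -> : @tcons _ (measurableTypeR R) n @^-1` box n.+1 M = `[- M, M]%classic `*` box n M.
  apply/seteqP; split => -[x t] /=.
    move=> H; split => /=; first by have := H ord0; rewrite in_itv/= ler_norml.
    by move=> i; have := H (lift ord0 i); rewrite tnthS.
  move=> [xM tM] i; case: (unliftP ord0 i) => [j ->|->]; last first.
    by move: xM; rewrite in_itv/= -ler_norml.
  by rewrite tnthS; exact: tM.
rewrite product_measure1E//; last exact: measurable_box.
apply: lte_mul_pinfty => //.
have muM : (mu `[(- M)%R, M]%classic < +oo)%E.
  by rewrite lebesgue_measure_itv/=; case: ifP => // _; rewrite -EFinD ltry.
rewrite ge0_fin_numE; [exact: muM|exact: measure_ge0].
Qed.

(** A condition that ensures integrability and that is stable under freezing one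
    coordinate, so that it can go through an induction on the dimension. *)
Definition box_supported n (M : R) (f : TR n -> R) : Prop :=
  [/\ measurable_fun setT f, forall t, `|f t| <= M & forall t, f t != 0 -> box n M t].

Lemma box_supported_integrable n M (f : TR n -> R) : box_supported M f ->
  (lebesgue_tuple R n).-integrable setT (EFin \o f).
Proof.
move=> [mf fM fbox].
apply: (@le_integrable _ _ _ _ setT measurableT _ (EFin \o (cst M \* \1_(box n M))%R)).
- exact/measurable_EFinP.
- move=> t _ /=; rewrite lee_fin indicE.
  have [t0|t0] := eqVneq (f t) 0; first by rewrite t0 normr0.
  by rewrite mem_set ?mulr1; [apply: le_trans (fM t) _; exact: ler_norm|exact: fbox].
- rewrite (_ : EFin \o _ = (fun t => M%:E * (\1_(box n M) t)%:E)%E); last first.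
    by apply/funext => t /=; rewrite EFinM.
  have mB := @measurable_box n M.
  apply: integrableZl => //; apply/integrableP; split.
    exact/measurable_EFinP/measurable_indic.
  rewrite (eq_integral (fun x => (\1_(box n M) x)%:E)); last first.
    by move=> t _; rewrite gee0_abs// lee_fin.
  by rewrite integral_indic// setIT lebesgue_tuple_box.
Qed.

Lemma integral_lebesgue_tupleS n (f : TR n.+1 -> R) :
  (lebesgue_tuple R n.+1).-integrable setT (EFin \o f) ->
  measurable_fun setT f ->
  [/\ ((mu \x lebesgue_tuple R n)%E).-integrable setT
     (EFin \o f \o @tcons _ (measurableTypeR R) n) &
   (\int[lebesgue_tuple R n.+1]_t (f t)%:E =
    \int[(mu \x lebesgue_tuple R n)%E]_z (f (@tcons _ (measurableTypeR R) n z))%:E)%E].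
Proof.
move=> intf mf; have mt := @measurable_tcons _ (measurableTypeR R) n.
have mEf : measurable_fun setT (EFin \o f) by exact/measurable_EFinP.
have E (g : TR n.+1 -> \bar R) : (\int[lebesgue_tuple R n.+1]_t g t =
    \int[pushforward (mu \x lebesgue_tuple R n)%E (@tcons _ (measurableTypeR R) n)]_t g t)%E.
  exact: eq_measure_integral.
have i2 : ((mu \x lebesgue_tuple R n)%E).-integrable setT
    (EFin \o f \o @tcons _ (measurableTypeR R) n).
  apply/integrableP; split; first by apply: measurableT_comp.
  move/integrableP : intf => [_]; apply: le_lt_trans.
  rewrite E ge0_integral_pushforward//=.
  by apply/measurable_EFinP; exact: (measurableT_comp (@normr_measurable R setT) mf).
split=> //; rewrite E integral_pushforward//.
Qed.

Definition update_coord n (t : TR n) (i : 'I_n) (s : R) : TR n :=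
  [tuple if j == i then s else tnth t j | j < n].

Lemma box_supported_cons n M (f : TR n.+1 -> R) (x : R) :
  box_supported M f -> box_supported M (fun t : TR n => f (@tcons _ (measurableTypeR R) n (x, t))).
Proof.
move=> [mf fM fb]; split => //.
  apply: measurableT_comp => //.
  exact: (measurable_cons (@measurable_cst _ _ _ _ setT (x : measurableTypeR R))
    (@measurable_id _ _ setT)).
by move=> t /fb H i; have := H (lift ord0 i); rewrite tnthS.
Qed.

(** Fubini: for the first coordinate, the integral along it is the inner one; for
    another coordinate the first one is frozen. *)
Lemma integral_lines0 n M (f : TR n -> R) (i : 'I_n) : box_supported M f ->
  (forall t, (\int[mu]_s (f (update_coord t i s))%:E = 0)%E) ->
  (\int[lebesgue_tuple R n]_t (f t)%:E = 0)%E.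
Proof.
elim: n f i => [f []//|n IH f i bf f0].
have [mf fM fb] := bf.
have intf := box_supported_integrable bf.
have [intf' ->] := integral_lebesgue_tupleS intf mf.
case: (unliftP ord0 i) f0 => [j ->|->] f0; last first.
  rewrite -(integral21_prod_meas1 intf').
  rewrite (eq_integral (cst 0%E)) ?integral0// => t _ /=.
  rewrite -[RHS](f0 (@tcons _ (measurableTypeR R) n (0, t))).
  apply: eq_integral => s _; congr (f _)%:E; apply: eq_from_tnth => k.
  rewrite tnth_mktuple; case: (unliftP ord0 k) => [l ->|->]; last by rewrite eqxx.
  by rewrite eq_sym (negbTE (neq_lift _ _)) /tcons !tnthS.
rewrite -(integral12_prod_meas1 intf').
rewrite (eq_integral (cst 0%E)) ?integral0// => x _ /=.
apply: (IH _ j (box_supported_cons x bf)) => t.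
rewrite -[RHS](f0 (@tcons _ (measurableTypeR R) n (x, t))).
apply: eq_integral => s _; congr (f _)%:E; apply: eq_from_tnth => k.
rewrite tnth_mktuple; case: (unliftP ord0 k) => [l ->|->].
  by rewrite (inj_eq lift_inj) /tcons !tnthS tnth_mktuple.
by rewrite (negbTE (neq_lift _ _)).
Qed.

End boxes.

Section compactly_supported.
Context {R : realType}.
Local Notation mu := (@lebesgue_measure R).

Lemma FTC_segment (F f : R -> R) (a b : R) : a < b ->
  (forall x, a <= x <= b -> is_derive x 1 F (f x)) ->
  (forall x, a <= x <= b -> {for x, continuous f}) ->
  (\int[mu]_(x in `[a, b]) (f x)%:E = (F b - F a)%:E)%E.
Proof.
move=> ab dF cf.
have cF (x : R) : a <= x <= b -> {for x, continuous F}.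
  by move=> /dF[d _]; apply/differentiable_continuous/derivable1_diffP.
have aab : a <= a <= b by rewrite lexx ltW.
have bab : a <= b <= b by rewrite lexx ltW.
have sub (x : R) : x \in `]a, b[%R -> a <= x <= b.
  by rewrite in_itv/= => /andP[? ?]; apply/andP; split; exact: ltW.
rewrite EFinB; apply: continuous_FTC2 => //.
- apply/(continuous_within_itvP _ ab); split.
  + by move=> x /sub; exact: cf.
  + by apply: cvg_at_right_filter; exact: cf.
  + by apply: cvg_at_left_filter; exact: cf.
- split.
  + by move=> x /sub /dF[].
  + by apply: cvg_at_right_filter; exact: cF.
  + by apply: cvg_at_left_filter; exact: cF.
- by move=> x /sub /dF [_ <-]; rewrite derive1E.
Qed.

Lemma is_derive_line (V : normedModType R) (F : V -> R) (v y : V) (s d : R) :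
  is_derive (s *: v + y) v F d -> is_derive s 1 (fun s => F (s *: v + y)) d.
Proof.
have E : (fun h : R => h^-1 *: (((fun s => F (s *: v + y)) \o shift s) (h *: 1) -
      F (s *: v + y))) =
   (fun h : R => h^-1 *: ((F \o shift (s *: v + y)) (h *: v) - F (s *: v + y))).
  apply/funext => h /=; congr (_ *: (F _ - _)).
  by rewrite addrA -scalerDl; congr (_ *: _ + _); rewrite /GRing.scale/= mulr1.
by move=> [e1 e2]; split; [rewrite /derivable E|rewrite /derive E].
Qed.

Context {n : nat}.
Local Notation TR := (n.+1.-tuple (measurableTypeR R)).
Implicit Types f g F G : 'rV[R]_n.+1 -> R.

Definition Cc f : Prop :=
  continuous f /\ exists M, forall x, f x != 0 -> forall i, `|x ord0 i| <= M.

Definition integ f : R := (\int[lebesgue_tuple R n.+1]_t f (row_of_tuple t))%R.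

Lemma Cc_bounded f : Cc f -> exists M, 0 < M /\ box_supported M (f \o row_of_tuple : TR -> R).
Proof.
move=> [cf [M fM]].
pose K := [set v : 'rV[R]_n.+1 | forall i, v ord0 i \in `[(- `|M|), `|M|]].
have cK : compact K.
  apply: (@rV_compact _  _ (fun=> `[(- `|M|), `|M|]%classic)).
  by move=> _; apply: segment_compact.
have K0 : K !=set0.
  by exists 0 => i; rewrite mxE in_itv/= lerNl oppr0 normr_ge0.
have cnf : continuous (fun x => `|f x|).
  by move=> x; apply: (continuous_comp (cf x)); exact: norm_continuous.
have [c _ cmax] := EVT_max_rV K0 cK (continuous_subspaceT cnf).
exists (`|M| + `|f c| + 1); split; first by rewrite ltr_wpDl// addr_ge0.
split; first exact: measurable_continuous.
- move=> t /=; have [->|/fM H] := eqVneq (f (row_of_tuple t)) 0.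
    by rewrite normr0 !addr_ge0.
  have /cmax : row_of_tuple t \in K.
    by rewrite inE => i; rewrite in_itv/= -ler_norml (le_trans (H i))// ler_norm.
  by move=> /le_trans; apply; rewrite -addrA addrCA lerDl addr_ge0.
- move=> t /= /fM H i; have := H i; rewrite mxE => /le_trans; apply.
  by apply: (le_trans (ler_norm _)); rewrite -addrA lerDl addr_ge0.
Qed.

Lemma Cc_integrable f : Cc f ->
  (lebesgue_tuple R n.+1).-integrable setT (EFin \o (f \o row_of_tuple : TR -> R)).
Proof. by move=> /Cc_bounded[M [_]]; exact: box_supported_integrable. Qed.

Lemma CcD f g : Cc f -> Cc g -> Cc (f \+ g).
Proof.
move=> [cf [M fM]] [cg [K gK]]; split.
  by move=> x; apply: continuousD; [exact: cf|exact: cg].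
exists (Num.max M K) => x; have [f0|/fM H _ i] := eqVneq (f x) 0.
  by rewrite /= f0 add0r => /gK H i; rewrite le_max H orbT.
by rewrite le_max H.
Qed.

Lemma CcZ (k : R) f : Cc f -> Cc (fun x => k * f x).
Proof.
move=> [cf [M fM]]; split.
  by move=> x; apply: continuousM; [exact: cst_continuous|exact: cf].
by exists M => x H; apply: fM; apply: contraNneq H => ->; rewrite mulr0.
Qed.

Lemma integD f g : Cc f -> Cc g -> integ (f \+ g) = integ f + integ g.
Proof. by move=> cf cg; rewrite /integ RintegralD//; exact: Cc_integrable. Qed.

Lemma integZ k f : Cc f -> integ (fun x => k * f x) = k * integ f.
Proof. by move=> cf; rewrite /integ RintegralZl//; exact: Cc_integrable. Qed.

Lemma le_integ f g : Cc f -> Cc g -> (forall x, f x <= g x) -> integ f <= integ g.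
Proof. by move=> cf cg fg; apply: le_Rintegral => //; exact: Cc_integrable. Qed.

Lemma row_of_update (t : TR) i (s : R) :
  row_of_tuple (update_coord t i s) =
  s *: delta_mx ord0 i + row_of_tuple (update_coord t i 0).
Proof.
apply/rowP => j; rewrite !mxE !tnth_mktuple eqxx/=.
by case: eqP => _; rewrite ?mulr1 ?addr0// mulr0 add0r.
Qed.

(** On each line parallel to the [i]-th axis the integral of [G] is the variation
    of [F] between two points outside of its support. *)
Lemma integ_derivative0 F G i : Cc G ->
  (exists M, forall x, F x != 0 -> forall i, `|x ord0 i| <= M) ->
  (forall x, is_derive x (delta_mx ord0 i) F (G x)) -> integ G = 0.
Proof.
move=> cG [K FK] dF; have [cG' [K' GK]] := cG.
have [M [M0 bG]] := Cc_bounded cG.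
rewrite /integ /Rintegral (integral_lines0 (i := i) bG)// => t /=.
pose B := `|K| + `|K'| + 1.
have B0 : 0 < B by rewrite ltr_wpDl// addr_ge0.
set y := row_of_tuple (update_coord t i 0).
have E s : row_of_tuple (update_coord t i s) = s *: delta_mx ord0 i + y by rewrite row_of_update.
have ci s : (s *: delta_mx ord0 i + y) ord0 i = s.
  by rewrite -E mxE tnth_mktuple eqxx.
have FTC := @FTC_segment (fun s => F (s *: delta_mx ord0 i + y))
  (fun s => G (s *: delta_mx ord0 i + y)) (- B) B.
have -> : (\int[mu]_s (G (row_of_tuple (update_coord t i s)))%:E =
    \int[mu]_(s in `[(- B)%R, B]) (G (s *: delta_mx ord0 i + y))%:E)%E.
  rewrite [RHS]integral_mkcond; apply: eq_integral.
  move=> s _ /=; rewrite patchE; case: ifPn => [|]; first by rewrite E.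
  rewrite E notin_setE/= in_itv/= -ler_norml => sB.
  have [->//|/GK/(_ i)] := eqVneq (G (s *: delta_mx ord0 i + y)) 0.
  rewrite ci => H; exfalso; apply: sB; apply: le_trans H _; apply: le_trans (ler_norm _) _.
  by rewrite /B -addrA addrCA lerDl addr_ge0.
have mBB : - B < B by rewrite gtrN.
have dline (s : R) : - B <= s <= B ->
    is_derive s 1 (fun s : R => F (s *: delta_mx ord0 i + y)) (G (s *: delta_mx ord0 i + y)).
  by move=> _; apply: is_derive_line.
have cline (s : R) : - B <= s <= B ->
    {for s, continuous (fun s : R => G (s *: delta_mx ord0 i + y))}.
  move=> _; apply: (@continuous_comp _ _ _ (fun s : R => s *: delta_mx ord0 i + y) G);
    last exact: cG'.
  by apply: continuousD; [exact: scalel_continuous|exact: cst_continuous].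
apply: (etrans (FTC mBB dline cline)).
have F0 (s : R) : B <= `|s| -> F (s *: delta_mx ord0 i + y) = 0.
  move=> Bs; have [//|/FK/(_ i)] := eqVneq (F (s *: delta_mx ord0 i + y)) 0.
  rewrite ci leNgt => /negP; case; apply: lt_le_trans Bs.
  by rewrite /B -addrA; apply: (le_lt_trans (ler_norm _)); rewrite ltrDl ltr_wpDl.
by rewrite !F0 ?subrr// ?normrN ler_norm.
Qed.

End compactly_supported.

(** * Rules of differentiation *)
Section chain_rule.
Context {R : realType} {V : normedModType R}.

(** Directional derivatives are derivatives of functions of one real variable;
    this is how the chain rule for an outer function of one variable holds
    without the inner one being differentiable. *)
Lemma is_derive_lineP (F : V -> R) (x v : V) (d : R) :
  is_derive x v F d <-> is_derive (0 : R) 1 (fun s : R => F (s *: v + x)) d.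
Proof.
split=> [H|]; first by apply: is_derive_line; rewrite scale0r add0r.
have E : (fun h : R => h^-1 *: ((F \o shift x) (h *: v) - F x)) =
   (fun h : R => h^-1 *: (((fun s : R => F (s *: v + x)) \o shift 0) (h *: 1) -
      F (0 *: v + x))).
  apply/funext => h /=; rewrite scale0r add0r addr0; congr (_ *: (F (_ *: _ + _) - _)).
  by rewrite /GRing.scale/= mulr1.
by move=> [e1 e2]; split; [rewrite /derivable E|rewrite /derive E].
Qed.

Lemma is_derive_comp1 (h : R -> R) (g : V -> R) (x v : V) (dh dg : R) :
  is_derive (g x) 1 h dh -> is_derive x v g dg -> is_derive x v (h \o g) (dh * dg).
Proof.
move=> H1 /is_derive_lineP H2; apply/is_derive_lineP.
apply: (@is_derive1_comp _ h (fun s : R => g (s *: v + x))) => //.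
by rewrite scale0r add0r.
Qed.

End chain_rule.

Section absolute_power.
Context {R : realType}.
Implicit Types p q t : R.

Definition abs_pow p t : R := `|t| `^ p.
Definition abs_dpow p t : R := p * `|t| `^ (p - 1) * Num.sg t.

Lemma abs_pow_near_pos p t : 0 < t -> \forall z \near t, z `^ p = abs_pow p z.
Proof.
by move=> t0; near=> z; rewrite /abs_pow gtr0_norm//; near: z; exact: lt_nbhsr.
Unshelve. all: by end_near. Qed.

Lemma is_derive_abs_pow_pos p t : 0 < t -> is_derive t 1 (abs_pow p) (abs_dpow p t).
Proof.
move=> t0; rewrite /abs_dpow gtr0_sg// mulr1 gtr0_norm//.
exact: (near_eq_is_derive (abs_pow_near_pos p t0) (is_derive1_powR p t0)).
Qed.

Lemma abs_powN p t : abs_pow p (- t) = abs_pow p t.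
Proof. by rewrite /abs_pow normrN. Qed.

Lemma is_derive_abs_pow_neq0 p t : t != 0 -> is_derive t 1 (abs_pow p) (abs_dpow p t).
Proof.
case: (ltgtP t 0) => // t0 _; last exact: is_derive_abs_pow_pos.
have -> : abs_pow p = abs_pow p \o -%R by apply/funext => z /=; rewrite abs_powN.
have -> : abs_dpow p t = abs_dpow p (- t) * - 1.
  by rewrite /abs_dpow normrN ltr0_sg// gtr0_sg ?oppr_gt0// mulr1.
by apply: is_derive1_comp; apply: is_derive_abs_pow_pos; rewrite oppr_gt0.
Qed.

Lemma continuous_abs_pow q : 0 < q -> continuous (abs_pow q).
Proof.
move=> q0 t; have [->|t0] := eqVneq t 0; last first.
  have [d _] := is_derive_abs_pow_neq0 q t0.
  exact/differentiable_continuous/derivable1_diffP.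
apply/cvgrPdist_lt => e e0.
have H : \forall x \near (0 : R), `|x| < e `^ q^-1.
  by apply: nbhs0_lt; exact: powR_gt0.
near=> z; rewrite /abs_pow normr0 powR0 ?gt_eqF// sub0r normrN ger0_norm ?powR_ge0//.
have -> : e = (e `^ q^-1) `^ q by rewrite -powRrM mulVf ?gt_eqF// powRr1// ltW.
rewrite gt0_ltr_powR ?nnegrE ?powR_ge0//.
near: z; exact: H.
Unshelve. all: by end_near. Qed.

(** At [0] the difference quotient is [|z|^(p-1)] up to sign. *)
Lemma is_derive_abs_pow p t : 1 < p -> is_derive t 1 (abs_pow p) (abs_dpow p t).
Proof.
move=> p1; have [->|] := eqVneq t 0; last exact: is_derive_abs_pow_neq0.
have pB0 : 0 < p - 1 by rewrite subr_gt0.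
rewrite /abs_dpow sgr0 mulr0; apply/is_derive1_caratheodory.
exists (fun z => abs_pow (p - 1) z * Num.sg z); split.
- move=> z; rewrite /abs_pow normr0 powR0 ?subr0; last by rewrite gt_eqF// (lt_trans ltr01).
  rewrite ?subr0 -mulrA -normrEsg mulrC.
  by rewrite mulr_powRB1// (lt_trans ltr01).
- apply/cvgrPdist_lt => e e0; have := @continuous_abs_pow _ pB0 0.
  move=> /cvgrPdist_lt/(_ e e0) H; near=> z.
  rewrite sgr0 mulr0 sub0r normrN normrM.
  have : `|abs_pow (p - 1) 0 - abs_pow (p - 1) z| < e by near: z.
  rewrite [abs_pow _ 0]/abs_pow normr0 powR0 ?gt_eqF// sub0r normrN => H1.
  apply: le_lt_trans H1; rewrite ler_piMr//.
  by rewrite normr_sg; case: eqP.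
- by rewrite sgr0 mulr0.
Unshelve. all: by end_near. Qed.

Lemma continuous_abs_dpow p : 1 < p -> continuous (abs_dpow p).
Proof.
move=> p1 t; have pB0 : 0 < p - 1 by rewrite subr_gt0.
have p0 : 0 < p by apply: lt_trans p1.
have cp := @continuous_abs_pow _ pB0.
have [->|t0] := eqVneq t 0; last first.
  have sgE : \forall z \near t, Num.sg t = Num.sg z.
    case: (ltgtP t 0) t0 => // t0 _; near=> z.
      by rewrite !ltr0_sg//; near: z; exact: lt_nbhsl.
    by rewrite !gtr0_sg//; near: z; exact: lt_nbhsr.
  have H : (fun z => p * abs_pow (p - 1) z * Num.sg t) z @[z --> t] --> abs_dpow p t.
    by apply: cvgM; [apply: cvgM; [exact: cvg_cst|exact: cp]|exact: cvg_cst].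
  apply: cvg_trans H; apply: near_eq_cvg; near=> z.
  by rewrite /abs_dpow; congr (_ * _); apply/esym; near: z; apply: filterS sgE.
apply/cvgrPdist_lt => e e0; have e1 : 0 < e / p by rewrite divr_gt0.
have /cvgrPdist_lt/(_ _ e1) H := cp 0; near=> z.
rewrite /abs_dpow sgr0 mulr0 sub0r normrN !normrM.
have : `|abs_pow (p - 1) 0 - abs_pow (p - 1) z| < e / p by near: z.
rewrite {1}/abs_pow normr0 powR0 ?gt_eqF// sub0r normrN ltr_pdivlMr// => H1.
apply: le_lt_trans H1; rewrite (gtr0_norm p0) mulrAC -/(abs_pow _ _) [leRHS]mulrC.
rewrite mulrAC ler_piMr ?mulr_ge0// ?(ltW p0)//.
by rewrite normr_sg; case: eqP.
Unshelve. all: by end_near. Qed.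

End absolute_power.

Section pointed_derivatives.
Context {R : realType} {V : normedModType R}.
Implicit Types (f g : V -> R) (x v : V).

Lemma is_derive_mul f g x v df dg : is_derive x v f df -> is_derive x v g dg ->
  is_derive x v (fun z => f z * g z) (f x * dg + df * g x).
Proof.
move=> H1 H2; have -> : (fun z => f z * g z) = f * g by [].
by apply: (is_derive_eq (is_deriveM H1 H2)); rewrite /GRing.scale/= (mulrC (g x)).
Qed.

Lemma is_derive_add f g x v df dg : is_derive x v f df -> is_derive x v g dg ->
  is_derive x v (fun z => f z + g z) (df + dg).
Proof. by move=> H1 H2; exact: is_deriveD. Qed.

Lemma is_derive_sub f g x v df dg : is_derive x v f df -> is_derive x v g dg ->
  is_derive x v (fun z => f z - g z) (df - dg).
Proof. by move=> H1 H2; exact: is_deriveB. Qed.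

Lemma is_derive_bigsum m (h : 'I_m -> V -> R) (dh : 'I_m -> R) x v :
  (forall i, is_derive x v (h i) (dh i)) ->
  is_derive x v (fun z => \sum_i h i z) (\sum_i dh i).
Proof.
move=> H; have -> : (fun z => \sum_i h i z) = \sum_i h i.
  by apply/funext => z; rewrite fct_sumE.
exact: is_derive_sum.
Qed.

End pointed_derivatives.

Lemma continuous_bigsum (R : realType) (T : topologicalType) m (f : 'I_m -> T -> R) (x : T) :
  (forall k, {for x, continuous (f k)}) ->
  {for x, continuous (fun z => \sum_k f k z)}.
Proof.
move=> H; have -> : (fun z => \sum_k f k z) = \sum_k f k.
  by apply/funext => z; rewrite fct_sumE.
elim/big_ind : _ => [|g h cg ch|k _]; first exact: cst_continuous.
  exact: continuousD.
exact: H.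
Qed.

(** * Radial fields in the half-space *)
Section halfspace_geometry.
Context {R : realType} {n : nat}.
Implicit Types (x v : 'rV[R]_n.+1) (i j : 'I_n.+1).

Definition height x : R := x ord0 ord_max.

(** The hyperbolic cosine of the distance to [x0]. *)
Definition coshd x0 x : R :=
  1 + (\sum_i (x ord0 i - x0 ord0 i) ^+ 2) * (2 * height x0 * height x)^-1.

(** The derivative of [coshd x0] along the vector of Riemannian length one in the
    [i]-th direction, which is [height x] times the [i]-th basis vector. *)
Definition dcoshd x0 i x : R :=
  (x ord0 i - x0 ord0 i) / height x0 - (i == ord_max)%:R * (coshd x0 x - 1).

Lemma is_derive_coord x v i : is_derive x v (fun z => z ord0 i) (v ord0 i).
Proof.
apply/is_derive_lineP.
have -> : (fun s : R => (s *: v + x) ord0 i) =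
    (fun s : R => id s * cst (v ord0 i) s + cst (x ord0 i) s).
  by apply/funext => s; rewrite !mxE.
apply: (is_derive_eq (is_derive_add (is_derive_mul (is_derive_id (0 : R) (1 : R))
  (is_derive_cst (v ord0 i) (0 : R) (1 : R))) (is_derive_cst (x ord0 i) (0 : R) (1 : R)))).
by rewrite /= mulr0 add0r mul1r addr0.
Qed.

Lemma delta_coord i j : (delta_mx ord0 i : 'rV[R]_n.+1) ord0 j = (j == i)%:R.
Proof. by rewrite mxE eqxx. Qed.

Lemma is_derive_coordB x0 x i j :
  is_derive x (delta_mx ord0 i) (fun z => z ord0 j - x0 ord0 j) (j == i)%:R.
Proof.
rewrite -delta_coord -[X in is_derive _ _ _ X]subr0.
exact: (is_derive_sub (is_derive_coord x (delta_mx ord0 i) j)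
  (is_derive_cst (x0 ord0 j) x (delta_mx ord0 i))).
Qed.

Lemma is_derive_sqdist x0 x i :
  is_derive x (delta_mx ord0 i) (fun z => \sum_j (z ord0 j - x0 ord0 j) ^+ 2)
    (2 * (x ord0 i - x0 ord0 i)).
Proof.
have H j : is_derive x (delta_mx ord0 i) (fun z => (z ord0 j - x0 ord0 j) ^+ 2)
    ((x ord0 j - x0 ord0 j) * (j == i)%:R + (j == i)%:R * (x ord0 j - x0 ord0 j)).
  by apply: is_derive_mul; exact: is_derive_coordB.
apply: (is_derive_eq (is_derive_bigsum H)).
rewrite (bigD1 i)//= eqxx big1 ?addr0; first by rewrite mulr1n; ring.
by move=> j /negbTE ->; rewrite mulr0 mul0r addr0.
Qed.

Lemma is_derive_inv (f : 'rV[R]_n.+1 -> R) x v df : f x != 0 ->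
  is_derive x v f df -> is_derive x v (fun z => (f z)^-1) (- df / f x ^+ 2).
Proof.
move=> f0 H; have -> : - df / f x ^+ 2 = (- (f x ^+ 2)^-1) * df by rewrite mulrC mulrN mulNr.
apply: (@is_derive_comp1 _ _ (fun t => t^-1)) => //.
apply: (is_derive_eq (is_deriveV f0 (is_derive_id (f x) (1 : R)))).
by rewrite /GRing.scale/= mulr1.
Qed.

Lemma is_derive_height x i : is_derive x (delta_mx ord0 i) height (i == ord_max)%:R.
Proof. by rewrite eq_sym -delta_coord; exact: is_derive_coord. Qed.

Lemma is_derive_coshd x0 x i : 0 < height x0 -> 0 < height x ->
  is_derive x (delta_mx ord0 i) (coshd x0) (dcoshd x0 i x / height x).
Proof.
move=> b0 y0.
have c0 : 2 * height x0 * height x != 0 by rewrite gt_eqF ?mulr_gt0.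
have H1 : is_derive x (delta_mx ord0 i) (fun z => 2 * height x0 * height z)
   (2 * height x0 * (i == ord_max)%:R + 0 * height x).
  exact: (is_derive_mul (is_derive_cst (2 * height x0) x (delta_mx ord0 i)) (is_derive_height x i)).
have H2 := is_derive_add (is_derive_cst (1 : R) x (delta_mx ord0 i))
  (is_derive_mul (is_derive_sqdist x0 x i) (is_derive_inv c0 H1)).
apply: (is_derive_eq H2).
rewrite /dcoshd /coshd; set S := \sum_j _; field.
by rewrite !gt_eqF.
Qed.

Lemma coshd_ge1 x0 x : 0 < height x0 -> 0 < height x -> 1 <= coshd x0 x.
Proof.
move=> b0 y0; rewrite lerDl mulr_ge0 ?invr_ge0 ?mulr_ge0 ?(ltW b0) ?(ltW y0)//.
by rewrite sumr_ge0// => i _; rewrite sqr_ge0.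
Qed.

(** [|grad (cosh r)|^2 = sinh^2 r], computed in an orthonormal frame. *)
Lemma sum_dcoshd2 x0 x : 0 < height x0 -> 0 < height x ->
  \sum_i dcoshd x0 i x ^+ 2 = coshd x0 x ^+ 2 - 1.
Proof.
move=> b0 y0; set b := height x0 in b0 *; set z := coshd x0 x - 1.
set y := height x in y0.
have zE : \sum_i (x ord0 i - x0 ord0 i) ^+ 2 = 2 * b * y * z.
  rewrite /z /coshd -/b -/y addrC addKr mulrC divfK//.
  by rewrite gt_eqF ?mulr_gt0.
have E i : dcoshd x0 i x ^+ 2 = (x ord0 i - x0 ord0 i) ^+ 2 / b ^+ 2 +
   (if i == ord_max then z ^+ 2 - 2 * z * ((y - b) / b) else 0).
  rewrite /dcoshd -/b -/z; have [->|_] := eqVneq i ord_max.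
    by rewrite -/(height x) -/(height x0) -/y -/b /=; field; rewrite gt_eqF.
  by rewrite /= mul0r subr0 addr0; field; rewrite gt_eqF.
under eq_bigr do rewrite E.
rewrite big_split/= -mulr_suml zE -big_mkcond/= big_pred1_eq.
have -> : coshd x0 x = z + 1 by rewrite /z subrK.
by field; rewrite gt_eqF.
Qed.

Lemma continuous_coord i : continuous (fun x : 'rV[R]_n.+1 => x ord0 i).
Proof. by move=> x; exact: coord_continuous. Qed.

Lemma continuous_coshd x0 x : 0 < height x0 -> 0 < height x ->
  {for x, continuous (coshd x0)}.
Proof.
move=> b0 y0; apply: continuousD; first exact: cst_continuous.
apply: continuousM.
  apply: continuous_bigsum => i.
  have c : {for x, continuous (fun z : 'rV[R]_n.+1 => z ord0 i - x0 ord0 i)}.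
    by apply: continuousB; [exact: continuous_coord|exact: cst_continuous].
  exact: (continuousM c c).
apply: continuousV; first by rewrite gt_eqF ?mulr_gt0.
by apply: continuousM; [exact: cst_continuous|exact: continuous_coord].
Qed.

Lemma continuous_dcoshd x0 x i : 0 < height x0 -> 0 < height x ->
  {for x, continuous (dcoshd x0 i)}.
Proof.
move=> b0 y0; apply: continuousB.
  apply: continuousM; last exact: cst_continuous.
  by apply: continuousB; [exact: continuous_coord|exact: cst_continuous].
apply: continuousM; first exact: cst_continuous.
by apply: continuousB; [exact: continuous_coshd|exact: cst_continuous].
Qed.

(** The coordinates of the field [h(cosh r) grad (cosh r)] are [height x] times
    the components in the orthonormal frame; multiplied by the density
    [height x ^- n.+1] of the Riemannian measure, the field has a Euclidean
    divergence equal to the Riemannian one times this density. *)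
Definition radial_flux (h : R -> R) x0 i x : R :=
  height x ^- n * (h (coshd x0 x) * dcoshd x0 i x).

Definition radial_dflux (h dh : R -> R) x0 i x : R :=
  height x ^- n * (h (coshd x0 x) *
       ((height x0)^-1 - (i == ord_max)%:R * (dcoshd x0 i x / height x))
     + dh (coshd x0 x) * (dcoshd x0 i x / height x) * dcoshd x0 i x)
  - n%:R * (i == ord_max)%:R * height x ^- n.+1 * (h (coshd x0 x) * dcoshd x0 i x).

Lemma is_derive_dcoshd x0 x i : 0 < height x0 -> 0 < height x ->
  is_derive x (delta_mx ord0 i) (dcoshd x0 i)
    ((height x0)^-1 - (i == ord_max)%:R * (dcoshd x0 i x / height x)).
Proof.
move=> b0 y0; set d := delta_mx ord0 i.
have H1 := is_derive_mul (is_derive_coordB x0 x i i) (is_derive_cst (height x0)^-1 x d).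
have H2 := is_derive_mul (is_derive_cst ((i == ord_max)%:R : R) x d)
  (is_derive_sub (is_derive_coshd i b0 y0) (is_derive_cst (1 : R) x d)).
apply: (is_derive_eq (is_derive_sub H1 H2)).
by rewrite eqxx /=; ring.
Qed.

Lemma is_derive_heightNX x i : 0 < height x ->
  is_derive x (delta_mx ord0 i) (fun z => height z ^- n)
    (- (n%:R * (i == ord_max)%:R * height x ^- n.+1)).
Proof.
move=> y0.
have H1 : is_derive x (delta_mx ord0 i) (fun z => height z ^+ n)
   (n%:R * height x ^+ n.-1 * (i == ord_max)%:R).
  have -> : (fun z => height z ^+ n) = height ^+ n by apply/funext => z; rewrite !fctE.
  exact: (is_deriveX n (is_derive_height x i)).
have yn0 : height x ^+ n != 0 by rewrite gt_eqF ?exprn_gt0.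
apply: (is_derive_eq (is_derive_inv yn0 H1)).
have E (m : nat) (y e : R) : 0 < y ->
    - (m%:R * y ^+ m.-1 * e) / (y ^+ m) ^+ 2 = - (m%:R * e * y ^- m.+1).
  move=> y1; case: m => [|m]; first by rewrite !mul0r oppr0 mul0r.
  by rewrite /= !exprS; field; rewrite ?expf_neq0 ?gt_eqF ?exprn_gt0.
exact: E.
Qed.

Lemma is_derive_radial_flux h dh x0 x i : 0 < height x0 -> 0 < height x ->
  is_derive (coshd x0 x) 1 h (dh (coshd x0 x)) ->
  is_derive x (delta_mx ord0 i) (radial_flux h x0 i) (radial_dflux h dh x0 i x).
Proof.
move=> b0 y0 H.
have H1 := is_derive_comp1 H (is_derive_coshd i b0 y0).
have H2 := is_derive_mul H1 (is_derive_dcoshd i b0 y0).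
have H3 := is_derive_mul (is_derive_heightNX i y0) H2.
apply: (is_derive_eq H3).
by rewrite /radial_dflux /= mulNr.
Qed.

(** [div (h(s) grad s) = h'(s) |grad s|^2 + h(s) Laplacian(s)], where the
    Laplacian of [s = cosh r] is [N s] in dimension [N]. *)
Lemma sum_radial_dflux h dh x0 x : 0 < height x0 -> 0 < height x ->
  \sum_i radial_dflux h dh x0 i x =
  height x ^- n.+1 * (dh (coshd x0 x) * (coshd x0 x ^+ 2 - 1)
    + n.+1%:R * (coshd x0 x * h (coshd x0 x))).
Proof.
move=> b0 y0; rewrite -(sum_dcoshd2 b0 y0).
set S := coshd x0 x; set b := height x0 in b0 *; set y := height x in y0 *.
have yn : y ^- n.+1 * y = y ^- n by rewrite exprSr invfM mulfVK// gt_eqF.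
have wm : dcoshd x0 ord_max x = y / b - S.
  rewrite /dcoshd eqxx -/(height x) -/(height x0) -/b -/y -/S /=.
  by field; rewrite gt_eqF.
have E i : radial_dflux h dh x0 i x = y ^- n.+1 * (h S * (y / b)) +
    y ^- n.+1 * (dh S * dcoshd x0 i x ^+ 2) +
    (if i == ord_max then - (n.+1%:R * y ^- n.+1 * h S * (y / b - S)) else 0).
  rewrite /radial_dflux -/S -/b -/y -yn.
  have [->|_] := eqVneq i ord_max.
    by rewrite wm /= -natr1; field; rewrite !gt_eqF ?exprn_gt0.
  by rewrite /=; field; rewrite !gt_eqF ?exprn_gt0.
under eq_bigr do rewrite E.
rewrite big_split/= -big_mkcond/= big_pred1_eq big_split/= -!mulr_sumr.
rewrite sumr_const card_ord -mulr_natl.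
by ring.
Qed.

End halfspace_geometry.

Section test_functions.
Context {R : realType} {n : nat}.
Implicit Types (x v : 'rV[R]_n.+1) (i j : 'I_n.+1) (u f g : 'rV[R]_n.+1 -> R).

Lemma gradient_normE u x : 0 < height x ->
  metric_norm x (gradient u x) =
  height x * Num.sqrt (\sum_i (partial i u x) ^+ 2).
Proof.
move=> y0; set y := height x in y0 *.
rewrite /metric_norm /gradient /metric -/(height x) -/y.
rewrite invmx_scalar invrK !mul_mx_scalar.
rewrite scalerA mulVf ?expf_neq0 ?gt_eqF// scale1r.
rewrite linearZ/= -scalemxAr mxE mxE.
have -> : \sum_j differential_row u x ord0 j * (differential_row u x)^T j ord0 =
   \sum_i partial i u x ^+ 2.
  by apply: eq_bigr => j _; rewrite !mxE.
by rewrite sqrtrM ?sqr_ge0// sqrtr_sqr gtr0_norm.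
Qed.

Definition density x : R := height x ^- n.+1.

Lemma sqrt_det_metric x : 0 < height x -> Num.sqrt (\det (metric x)) = density x.
Proof.
move=> y0; rewrite /metric det_scalar /density -/(height x).
by rewrite -exprVn -exprM mulnC exprM sqrtr_sqr exprVn ger0_norm// invr_ge0 exprn_ge0// ltW.
Qed.

Lemma hyp_integralE f : (forall x, ~ halfspace x -> f x = 0) ->
  hyp_integral f = integ (fun x => f x * density x).
Proof.
move=> f0; rewrite /hyp_integral /integ Rintegral_mkcond.
apply: eq_Rintegral => t _; rewrite patchE; case: ifPn => [|].
  by rewrite inE /= => H; rewrite sqrt_det_metric.
by rewrite notin_setE /= => /f0 ->; rewrite mul0r.
Qed.

(** Made for products of a function supported in the support of [u] and of functions
    that are singular only at the boundary of the half-space. Near a point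
    outside of [K] such a product vanishes, as [K] is closed. *)
Lemma Cc_glue (K : set 'rV[R]_n.+1) g : compact K -> K `<=` halfspace ->
  (forall x, 0 < height x -> {for x, continuous g}) ->
  (forall x, ~ K x -> g x = 0) -> Cc g.
Proof.
move=> cK KH cg g0.
have clK : closed K by apply: compact_closed => //; exact: norm_hausdorff.
split.
  move=> x; have [Kx|Kx] := pselect (K x); first by apply: cg; exact: KH.
  have oK : open (~` K) by exact: closed_openC.
  have H : \forall z \near x, cst 0 z = g z.
    have : nbhs x (~` K) by exact: open_nbhs_nbhs.
    by apply: filterS => z Kz; rewrite g0.
  rewrite /continuous_at (g0 x Kx).
  have c0 : cst (0 : R) z @[z --> x] --> (0 : R) by apply: cst_continuous.
  by apply: cvg_trans c0; exact: (near_eq_cvg H).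
have [M [_ HM]] := compact_bounded cK.
exists (M + 1) => x gx i.
have Kx : K x by apply: contrapT => /g0 E; rewrite E eqxx in gx.
have M1 : M < M + 1 by rewrite ltrDl.
apply: le_trans (HM (M + 1) M1 x Kx).
have /mapP[j Hj ->] : `|x ord0 i| \in [seq `|x y.1 y.2| | y : 'I_1 * 'I_n.+1].
  by apply/mapP; exists (ord0, i) => //=; rewrite mem_enum.
by rewrite [leRHS]/Num.norm /= mx_normrE; apply/bigmax_geP; right => /=; exists j.
Qed.

Lemma smooth_is_derive u x i : smooth u -> is_derive x (delta_mx ord0 i) u (partial i u x).
Proof. by move=> /(_ 1%N)[du _]; apply: derivableP; exact: diff_derivable. Qed.

Lemma smooth_continuous_partial u i : smooth u -> continuous (partial i u).
Proof. by move=> /(_ 1%N)[_]. Qed.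

Lemma smooth_continuous u : smooth u -> continuous u.
Proof. by move=> /(_ 0%N). Qed.

(** From [0 <= sum (B a_i - C b_i)^2 = B (A B - C^2)]. *)
Lemma cauchy_schwarz_sum m (a b : 'I_m -> R) :
  `|\sum_i a i * b i| <= Num.sqrt (\sum_i a i ^+ 2) * Num.sqrt (\sum_i b i ^+ 2).
Proof.
set A := \sum_i a i ^+ 2; set B := \sum_i b i ^+ 2; set C := \sum_i a i * b i.
have A0 : 0 <= A by apply: sumr_ge0 => i _; exact: sqr_ge0.
have B0 : 0 <= B by apply: sumr_ge0 => i _; exact: sqr_ge0.
rewrite -sqrtrM// -sqrtr_sqr ler_sqrt ?mulr_ge0//.
have H : 0 <= \sum_i (B * a i - C * b i) ^+ 2.
  by apply: sumr_ge0 => i _; exact: sqr_ge0.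
have E : \sum_i (B * a i - C * b i) ^+ 2 = B * (A * B - C ^+ 2).
  under eq_bigr => i _.
    have -> : (B * a i - C * b i) ^+ 2 =
      B ^+ 2 * a i ^+ 2 + (- (2 * B * C)) * (a i * b i) + C ^+ 2 * b i ^+ 2 by ring.
    over.
  by rewrite !big_split/= -!mulr_sumr -/A -/B -/C; ring.
move: B0; rewrite le_eqVlt => /predU1P[B0|B0]; last first.
  by move: H; rewrite E pmulr_rge0// subr_ge0.
suff -> : C = 0 by rewrite expr0n/= -B0 mulr0.
apply: big1 => i _; have : b i ^+ 2 = 0.
  apply/eqP; rewrite eq_le sqr_ge0 andbT B0 /B (bigD1 i)//= lerDl.
  by apply: sumr_ge0 => j _; exact: sqr_ge0.
by move=> /eqP; rewrite expf_eq0/= => /eqP ->; rewrite mulr0.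
Qed.

End test_functions.

(** * Lower bounds of the energy *)
Section hyperbolic_radius.
Context {R : realType}.

Definition acosh (s : R) : R := ln (s + Num.sqrt (s ^+ 2 - 1)).

Lemma acosh_arg_ge1 (s : R) : 1 <= s -> 1 <= s + Num.sqrt (s ^+ 2 - 1).
Proof. by move=> s1; rewrite ler_wpDr ?sqrtr_ge0. Qed.

Lemma acosh_ge0 (s : R) : 1 <= s -> 0 <= acosh s.
Proof. by move=> s1; rewrite ln_ge0// acosh_arg_ge1. Qed.

Lemma coshK (s : R) : 1 <= s -> coshR (acosh s) = s.
Proof.
move=> s1; have a0 : 0 < s + Num.sqrt (s ^+ 2 - 1).
  exact: lt_le_trans ltr01 (acosh_arg_ge1 s1).
have s2 : 0 <= s ^+ 2 - 1 by rewrite subr_ge0 exprn_ege1.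
rewrite /coshR /acosh expRN lnK ?posrE//.
have E := sqr_sqrtr s2; set w := Num.sqrt _ in a0 E *.
have wE : (s + w)^-1 = s - w.
  apply: (mulfI (lt0r_neq0 a0)); rewrite divff ?gt_eqF//.
  have -> : (s + w) * (s - w) = s ^+ 2 - w ^+ 2 by ring.
  by rewrite E; ring.
by rewrite wE; field.
Qed.

Lemma sinhR_acosh (s : R) : 1 <= s -> sinhR (acosh s) = Num.sqrt (s ^+ 2 - 1).
Proof.
move=> s1; have := cosh2_sinh2 (acosh s); rewrite coshK// => E.
have -> : s ^+ 2 - 1 = sinhR (acosh s) ^+ 2 by rewrite -E; ring.
by rewrite sqrtr_sqr ger0_norm// sinhR_ge0// acosh_ge0.
Qed.

Lemma continuous_acosh (s : R) : 1 <= s -> {for s, continuous acosh}.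
Proof.
move=> s1; apply: continuous_comp; last first.
  by apply: continuous_ln; exact: lt_le_trans ltr01 (acosh_arg_ge1 s1).
apply: continuousD; first exact: cvg_id.
apply: continuous_comp; last exact: sqrt_continuous.
by apply: continuousB; [exact: exprn_continuous|exact: cst_continuous].
Qed.

End hyperbolic_radius.

Section weighted_energy.
Context {R : realType} {n : nat}.
Implicit Types (x v : 'rV[R]_n.+1) (i j : 'I_n.+1).
Variables (p : R) (x0 : 'rV[R]_n.+1) (u : 'rV[R]_n.+1 -> R).
Hypothesis p2 : 2 <= p.
Hypothesis b0 : 0 < height x0.
Hypothesis tu : test_function u.
Local Notation q := (p / (p - 1)).

(** The hyperbolic distance between [x] and [x0] in closed form. *)
Definition pole_dist x : R := acosh (coshd x0 x).
Definition gradient_length x : R := height x * Num.sqrt (\sum_i (partial i u x) ^+ 2).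

Let K := closure [set x | u x != 0].

Let p1 : 1 < p. Proof. by move: p2; lra. Qed.
Let p0 : 0 < p. Proof. exact: lt_trans ltr01 p1. Qed.
Let q0 : 0 < q. Proof. by rewrite divr_gt0//; move: p1; lra. Qed.

Let su : smooth u. Proof. by case: tu. Qed.
Let cK : compact K. Proof. by case: tu. Qed.
Let KH : K `<=` halfspace. Proof. by case: tu. Qed.

Lemma test_function0 x : ~ K x -> u x = 0.
Proof. by move=> Kx; apply: contrapT => /eqP ux; apply: Kx; exact: subset_closure. Qed.

Lemma test_function_near0 x : ~ K x -> \forall z \near x, u z = 0.
Proof.
move=> Kx; have oK : open (~` K) by apply: closed_openC; exact: closed_closure.
have : nbhs x (~` K) by exact: open_nbhs_nbhs.
by apply: filterS => z; exact: test_function0.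
Qed.

Lemma test_function_partial0 x i : ~ K x -> partial i u x = 0.
Proof.
move=> /test_function_near0 H; rewrite /partial.
by rewrite (@near_eq_derive _ _ _ u (cst 0) x)// derive_cst.
Qed.

Lemma test_function_height x : ~ 0 < height x -> u x = 0.
Proof. by move=> y; apply: test_function0 => /KH. Qed.

Lemma continuous_height x : {for x, continuous (@height R n)}.
Proof. exact: continuous_coord. Qed.

Lemma continuous_heightNX m x : 0 < height x -> {for x, continuous (fun z => height z ^- m)}.
Proof.
move=> y0; apply: continuousV; first by rewrite expf_neq0// gt_eqF.
apply: (@continuous_comp _ _ _ (@height R n) (fun t => t ^+ m)); first exact: continuous_height.
exact: exprn_continuous.
Qed.

Lemma continuous_abs_pow_u r x : 0 < r -> {for x, continuous (fun z => `|u z| `^ r)}.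
Proof.
move=> r0; apply: (@continuous_comp _ _ _ u (abs_pow r)); first exact: smooth_continuous.
exact: continuous_abs_pow.
Qed.

Lemma Cc_mass : Cc (fun x => `|u x| `^ p * density x).
Proof.
apply: (Cc_glue cK KH) => x; last first.
  by move=> /test_function0 ->; rewrite normr0 powR0 ?mul0r// gt_eqF.
move=> y0; apply: continuousM; last exact: continuous_heightNX.
exact: continuous_abs_pow_u.
Qed.

Lemma pole_dist_ge0 x : 0 < height x -> 0 <= pole_dist x.
Proof. by move=> y0; apply: acosh_ge0; exact: coshd_ge1. Qed.

Lemma Cc_moment : Cc (fun x => `|u x| `^ p * `|pole_dist x| `^ q * density x).
Proof.
apply: (Cc_glue cK KH) => x; last first.
  by move=> /test_function0 ->; rewrite normr0 powR0 ?mul0r// gt_eqF.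
move=> y0; apply: continuousM; last exact: continuous_heightNX.
apply: continuousM; first exact: continuous_abs_pow_u.
apply: (@continuous_comp _ _ _ pole_dist (abs_pow q)); last exact: continuous_abs_pow.
apply: continuous_comp; first exact: continuous_coshd.
by apply: continuous_acosh; exact: coshd_ge1.
Qed.

Lemma Cc_energy : Cc (fun x => `|gradient_length x| `^ p * density x).
Proof.
apply: (Cc_glue cK KH) => x; last first.
  move=> Kx; rewrite /gradient_length big1; last first.
    by move=> i _; rewrite test_function_partial0// expr0n.
  by rewrite sqrtr0 mulr0 normr0 powR0 ?mul0r// gt_eqF.
move=> y0; apply: continuousM; last exact: continuous_heightNX.
apply: (@continuous_comp _ _ _ gradient_length (abs_pow p)); last first.
  exact: continuous_abs_pow.
apply: continuousM; first exact: continuous_height.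
apply: continuous_comp; last exact: sqrt_continuous.
apply: continuous_bigsum => i.
have c : {for x, continuous (partial i u)} by exact: smooth_continuous_partial.
exact: (continuousM c c).
Qed.

Variables (h dh : R -> R).
Hypothesis dhE : forall s : R, 1 <= s -> is_derive s 1 h (dh s).
Hypothesis cdh : forall s : R, 1 <= s -> {for s, continuous dh}.
Hypothesis h0 : forall s : R, 1 <= s -> 0 <= h s.

(** The [i]-th partial derivative of [|u|^p radial_flux h x0 i], which is zero
    off the support of [u]. *)
Definition flux_partial i x : R :=
  `|u x| `^ p * radial_dflux h dh x0 i x +
  abs_dpow p (u x) * partial i u x * radial_flux h x0 i x.

Lemma continuous_h (s : R) : 1 <= s -> {for s, continuous h}.
Proof. by move=> /dhE[d _]; apply/differentiable_continuous/derivable1_diffP. Qed.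

Lemma Cc_flux_partial i : Cc (flux_partial i).
Proof.
apply: (Cc_glue cK KH) => x; last first.
  move=> /test_function0 ux; rewrite /flux_partial ux normr0 powR0 ?gt_eqF//.
  by rewrite /abs_dpow sgr0 mulr0 !mul0r addr0.
move=> y0.
have s1 := coshd_ge1 b0 y0.
have cs : {for x, continuous (coshd x0)} by exact: continuous_coshd.
have cd : {for x, continuous (dcoshd x0 i)} by exact: continuous_dcoshd.
have ch : {for x, continuous (h \o coshd x0)}.
  by apply: continuous_comp => //; exact: continuous_h.
have cdhs : {for x, continuous (dh \o coshd x0)}.
  by apply: continuous_comp => //; exact: cdh.
have cy1 : {for x, continuous (fun z => (height z)^-1)}.
  by apply: continuousV; [rewrite gt_eqF|exact: continuous_height].
have cn m : {for x, continuous (fun z => height z ^- m)} by exact: continuous_heightNX.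
have cc (a : R) : {for x, continuous (fun _ : 'rV[R]_n.+1 => a)} by exact: cst_continuous.
have cdy : {for x, continuous (fun z => dcoshd x0 i z / height z)} by exact: continuousM.
apply: continuousD.
  apply: continuousM; first exact: continuous_abs_pow_u.
  apply: continuousB.
    apply: continuousM; first exact: cn.
    apply: continuousD.
      apply: continuousM => //; apply: continuousB; first exact: cc.
      by apply: continuousM => //; exact: cc.
    by apply: continuousM => //; apply: continuousM.
  apply: continuousM; last exact: continuousM.
  apply: continuousM; last exact: cn.
  exact: cc.
apply: continuousM.
  apply: continuousM; last exact: smooth_continuous_partial.
  apply: (@continuous_comp _ _ _ u (abs_dpow p)); first exact: smooth_continuous.
  exact: continuous_abs_dpow.
by apply: continuousM; [exact: cn|exact: continuousM].
Qed.

Lemma integ_flux_partial i : integ (flux_partial i) = 0.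
Proof.
apply: (@integ_derivative0 _ _ (fun x => `|u x| `^ p * radial_flux h x0 i x)
  (flux_partial i) i (Cc_flux_partial i)).
  have [_ [M HM]] := Cc_mass; exists M => x Fx; apply: HM.
  have y0 : 0 < height x.
    apply: contrapT => /test_function_height ux; move: Fx.
    by rewrite ux normr0 powR0 ?mul0r ?eqxx// gt_eqF.
  apply: contraNneq Fx => /eqP; rewrite mulf_eq0 => /orP[/eqP ->|].
    by rewrite mul0r.
  by rewrite /density invr_eq0 expf_eq0/= gt_eqF.
move=> x; have [Kx|Kx] := pselect (K x); last first.
  have -> : flux_partial i x = 0.
    rewrite /flux_partial test_function0// normr0 powR0 ?gt_eqF//.
    by rewrite /abs_dpow sgr0 mulr0 !mul0r addr0.
  have Hc := is_derive_cst (0 : R) x (delta_mx ord0 i).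
  apply: (near_eq_is_derive _ Hc).
  have H := test_function_near0 Kx; near=> z.
  have -> : u z = 0 by near: z; exact: H.
  by rewrite normr0 powR0 ?mul0r// gt_eqF.
have y0 : 0 < height x by exact: KH.
have s1 := coshd_ge1 b0 y0.
have H1 := is_derive_comp1 (is_derive_abs_pow (u x) p1) (smooth_is_derive x i su).
have H2 := is_derive_radial_flux i b0 y0 (dhE s1).
exact: (is_derive_eq (is_derive_mul H1 H2)).
Unshelve. all: by end_near. Qed.

Lemma integ_sum_flux_partial : Cc (fun x => \sum_i flux_partial i x) /\
  integ (fun x => \sum_i flux_partial i x) = 0.
Proof.
elim: (index_enum _) => [|i r [Cr Er]].
  have E : (fun x => \sum_(i <- [::]) flux_partial i x) = fun x => 0 * (`|u x| `^ p * density x).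
    by apply/funext => x; rewrite big_nil mul0r.
  by rewrite E; split; [exact: CcZ Cc_mass|rewrite (integZ _ Cc_mass) mul0r].
have E : (fun x => \sum_(j <- i :: r) flux_partial j x) =
    flux_partial i \+ (fun x => \sum_(j <- r) flux_partial j x).
  by apply/funext => x; rewrite big_cons.
rewrite E; split; first by apply: CcD => //; exact: Cc_flux_partial.
by rewrite integD// ?integ_flux_partial ?Er ?addr0//; exact: Cc_flux_partial.
Qed.

Variables alpha beta : R.
Hypothesis weight : forall r : R, 0 <= r ->
  alpha - beta * r `^ q <=
  dh (coshR r) * (coshR r ^+ 2 - 1) + n.+1%:R * (coshR r * h (coshR r))
  - (p - 1) * (h (coshR r) * sinhR r) `^ q.

(** The sum of the [flux_partial] is [div (|u|^p X)] times the density. In it the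
    cross term is at most [p |u|^(p-1) |grad u| |X|] by Cauchy-Schwarz, hence at
    most [|grad u|^p + (p - 1) |u|^p |X|^q] by Young's inequality. *)
Lemma pointwise_energy x :
  alpha * (`|u x| `^ p * density x) + (- beta) * (`|u x| `^ p * `|pole_dist x| `^ q * density x) <=
  `|gradient_length x| `^ p * density x + \sum_i flux_partial i x.
Proof.
have [y0|y0] := pselect (0 < height x); last first.
  have Kx : ~ K x by move=> /KH.
  have ux := test_function0 Kx.
  rewrite ux normr0 powR0 ?gt_eqF// !mul0r !mulr0 addr0.
  rewrite {1}/gradient_length big1; last first.
    by move=> i _; rewrite test_function_partial0// expr0n.
  rewrite sqrtr0 mulr0 normr0 powR0 ?gt_eqF// mul0r big1 ?addr0// => i _.
  rewrite /flux_partial ux normr0 powR0 ?gt_eqF//.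
  by rewrite /abs_dpow sgr0 mulr0 !mul0r addr0.
have s1 := coshd_ge1 b0 y0.
have d0 : 0 < density x by rewrite invr_gt0 exprn_gt0.
have hs := h0 s1.
have R0 := pole_dist_ge0 y0.
have W := weight R0; rewrite /pole_dist coshK// sinhR_acosh// -/(pole_dist x) in W.
set s := coshd x0 x in s1 hs W.
set S := Num.sqrt (s ^+ 2 - 1) in W.
have S0 : 0 <= S by exact: sqrtr_ge0.
set U := `|u x|; have U0 : 0 <= U by exact: normr_ge0.
have gl0 : 0 <= gradient_length x by rewrite mulr_ge0 ?sqrtr_ge0// ltW.
set C := \sum_i partial i u x * dcoshd x0 i x.
have CS : height x * `|C| <= gradient_length x * S.
  rewrite /gradient_length -mulrA ler_pM2l//.
  apply: le_trans (cauchy_schwarz_sum _ _) _.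
  by rewrite sum_dcoshd2.
have FE : \sum_i flux_partial i x = density x * (U `^ p *
   (dh s * (s ^+ 2 - 1) + n.+1%:R * (s * h s)) + abs_dpow p (u x) * (h s * (height x * C))).
  rewrite /flux_partial big_split/= -mulr_sumr sum_radial_dflux// -/s -/(density x).
  have -> : \sum_i abs_dpow p (u x) * partial i u x * radial_flux h x0 i x =
      density x * (abs_dpow p (u x) * (h s * (height x * C))).
    rewrite /C !mulr_sumr; apply: eq_bigr => i _.
    rewrite /radial_flux /density -/s exprSr invfM.
    by field; rewrite expf_neq0 gt_eqF.
  by rewrite /U; ring.
have DU : `|abs_dpow p (u x)| <= p * U `^ (p - 1).
  rewrite /abs_dpow !normrM (gtr0_norm p0) (ger0_norm (powR_ge0 _ _)).
  rewrite ler_piMr ?mulr_ge0 ?powR_ge0 ?(ltW p0)//.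
  by rewrite normr_sg; case: eqP.
set V := h s * S; have V0 : 0 <= V by rewrite mulr_ge0.
have pq : p^-1 + q^-1 = 1.
  rewrite invf_div -{1}(div1r p) -mulrDl subrKC mulfV// gt_eqF//.
have Y := conjugate_powR gl0 (mulr_ge0 V0 (powR_ge0 U (p - 1))) p0 q0 pq.
have Uq : (V * U `^ (p - 1)) `^ q = V `^ q * U `^ p.
  rewrite powRM ?powR_ge0// -powRrM mulrCA divff ?mulr1// gt_eqF// subr_gt0//.
have pB1 : 0 < p - 1 by rewrite subr_gt0.
have {}Y : p * (gradient_length x * (V * U `^ (p - 1))) <=
    gradient_length x `^ p + (p - 1) * (V `^ q * U `^ p).
  rewrite Uq in Y; have := ler_wpM2l (ltW p0) Y; congr (_ <= _).
  by field; rewrite !gt_eqF.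
have bound : - (gradient_length x `^ p + (p - 1) * (V `^ q * U `^ p)) <=
    abs_dpow p (u x) * (h s * (height x * C)).
  rewrite lerNl; apply: le_trans Y; apply: le_trans (ler_norm _) _.
  rewrite normrN [X in X <= _]normrM [`|h s * _|]normrM [`|height x * C|]normrM.
  rewrite (ger0_norm hs) (gtr0_norm y0).
  have -> : p * (gradient_length x * (V * U `^ (p - 1))) =
     p * U `^ (p - 1) * (h s * (gradient_length x * S)) by rewrite /V; ring.
  apply: ler_pM => //; last exact: ler_wpM2l.
  by apply: mulr_ge0 => //; apply: mulr_ge0 => //; exact: ltW.
rewrite FE (ger0_norm gl0) (ger0_norm R0).
have Up : 0 <= U `^ p by exact: powR_ge0.
have W2 := ler_wpM2l Up W; rewrite -/V in W2.
set M := dh s * (s ^+ 2 - 1) + n.+1%:R * (s * h s) in W2 *.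
have key : U `^ p * (alpha - beta * pole_dist x `^ q) <=
    gradient_length x `^ p + (U `^ p * M + abs_dpow p (u x) * (h s * (height x * C))).
  apply: le_trans W2 _; rewrite mulrBr.
  have -> : U `^ p * ((p - 1) * V `^ q) = (p - 1) * (V `^ q * U `^ p) by ring.
  by move: bound; lra.
have := ler_wpM2l (ltW d0) key; congr (_ <= _); ring.
Qed.

Lemma weighted_energy :
  alpha * integ (fun x => `|u x| `^ p * density x)
  - beta * integ (fun x => `|u x| `^ p * `|pole_dist x| `^ q * density x) <=
  integ (fun x => `|gradient_length x| `^ p * density x).
Proof.
have [CF EF] := integ_sum_flux_partial.
have cm := Cc_mass; have cM := Cc_moment; have cE := Cc_energy.
have := le_integ (CcD (CcZ alpha cm) (CcZ (- beta) cM)) (CcD cE CF) pointwise_energy.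
rewrite !integD//; [|exact: CcZ|exact: CcZ].
by rewrite EF addr0 !integZ// mulNr.
Qed.

End weighted_energy.

Section energy_gap.
Context {R : realType}.

(** The function [h] for which [h(s) grad s = c v(log s) grad (log s)]. *)
Definition profile_flux (c : R) (v : R -> R) (s : R) : R := c * v (ln s) * s^-1.
Definition profile_dflux (c : R) (v dv : R -> R) (s : R) : R :=
  c * (dv (ln s) - v (ln s)) * s ^- 2.

Lemma is_derive_profile_flux c (v dv : R -> R) (s : R) : 1 <= s ->
  is_derive (ln s) 1 v (dv (ln s)) ->
  is_derive s 1 (profile_flux c v) (profile_dflux c v dv s).
Proof.
move=> s1 H; have s0 : 0 < s by apply: lt_le_trans s1.
have H1 := is_derive1_comp H (is_derive1_ln s0).
have H2 := is_derive_mul (is_derive_cst c s (1 : R)) H1.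
have H3 := is_derive_mul H2 (is_deriveV (lt0r_neq0 s0) (is_derive_id s (1 : R))).
apply: (is_derive_eq H3).
by rewrite /profile_dflux /GRing.scale/=; field; rewrite gt_eqF.
Qed.

Lemma continuous_profile_dflux c (v dv : R -> R) (s : R) : 1 <= s ->
  is_derive (ln s) 1 v (dv (ln s)) -> {for ln s, continuous dv} ->
  {for s, continuous (profile_dflux c v dv)}.
Proof.
move=> s1 [H _] cdv; have s0 : 0 < s by apply: lt_le_trans s1.
have cl : {for s, continuous (@ln R)} by exact: continuous_ln.
have cv : {for ln s, continuous v} by exact/differentiable_continuous/derivable1_diffP.
apply: continuousM.
  apply: continuousM; first exact: cst_continuous.
  apply: continuousB; first exact: (continuous_comp cl cdv).
  exact: (continuous_comp cl cv).
apply: continuousV; first by rewrite expf_neq0// gt_eqF.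
exact: exprn_continuous.
Qed.

Context {n : nat}.
Variables (p : R) (x0 : 'rV[R]_n.+1) (u : 'rV[R]_n.+1 -> R).
Local Notation q := (p / (p - 1)).
Local Notation a := (n%:R / p).

(** The minorant [alpha - beta r^q] of the weight integrates to
    [alpha A - beta B >= (alpha - beta rho^q) A], because [beta >= 0]. *)
Lemma energy_gap (rho : R) : 2 <= p -> p - 1 <= a -> 0 < height x0 -> test_function u ->
  0 < rho ->
  integ (fun x => `|u x| `^ p * `|pole_dist x0 x| `^ q * density x) <=
    rho `^ q * integ (fun x => `|u x| `^ p * density x) ->
  hardy_level p a rho * integ (fun x => `|u x| `^ p * density x) <=
    integ (fun x => `|gradient_length u x| `^ p * density x).
Proof.
move=> p2 pa b0 tu rho0 moment.
have [c [v [dv [alpha [beta [[c0 be0] dvE cdv level weight]]]]]] := radial_profile p2 pa rho0.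
have p0 : 0 < p by lra.
have A0 : 0 <= integ (fun x => `|u x| `^ p * density x).
  rewrite /integ; apply: Rintegral_ge0 => t _.
  have [y0|/(test_function_height tu) ->] := pselect (0 < height (row_of_tuple t)).
    by rewrite mulr_ge0 ?powR_ge0// invr_ge0 exprn_ge0// ltW.
  by rewrite normr0 powR0 ?mul0r// gt_eqF.
have lns (s : R) : 1 <= s -> 0 <= ln s by exact: ln_ge0.
have H := @weighted_energy _ _ p x0 u p2 b0 tu (profile_flux c v) (profile_dflux c v dv)
  _ _ _ alpha beta _.
apply: le_trans (H _ _ _ _).
- apply: (@le_trans _ _ ((alpha - beta * rho `^ q) * integ (fun x => `|u x| `^ p * density x))).
    by rewrite ler_wpM2r.
  by rewrite mulrBl lerD2l lerN2 -mulrA ler_wpM2l.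
- by move=> s s1; apply: is_derive_profile_flux => //; apply: dvE; exact: lns.
- move=> s s1; apply: continuous_profile_dflux => //; first by apply: dvE; exact: lns.
  by have [] := cdv _ (lns _ s1).
- move=> s s1; rewrite /profile_flux mulr_ge0 ?invr_ge0 ?(le_trans ler01 s1)//.
  by rewrite mulr_ge0//; have [] := cdv _ (lns _ s1).
- move=> r r0; apply: le_trans (weight r r0) _.
  have cr := coshR_gt0 r.
  rewrite /profile_weight /profile_flux /profile_dflux le_eqVlt; apply/orP; left; apply/eqP.
  have -> : c * v (ln (coshR r)) * tanhR r = c * v (ln (coshR r)) * (coshR r)^-1 * sinhR r.
    by rewrite /tanhR; ring.
  congr (_ - _).
  have -> : tanhR r ^+ 2 = (coshR r ^+ 2 - 1) / coshR r ^+ 2.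
    by rewrite /tanhR -(cosh2_sinh2 r) opprB addrCA subrr addr0 expr_div_n.
  rewrite -natr1.
  by field; rewrite !gt_eqF.
Qed.

End energy_gap.

(** * The geodesic distance to a point *)
Section curves.
Context {R : realType} {n : nat}.
Local Notation mu := (@lebesgue_measure R).
Implicit Types (x v : 'rV[R]_n.+1) (g h : R -> 'rV[R]_n.+1) (t : R).

Lemma metric_normE x v : metric_norm x v = Num.sqrt (height x ^- 2 * \sum_i v ord0 i ^+ 2).
Proof.
rewrite /metric_norm /metric -/(height x) mul_mx_scalar -scalemxAl mxE mxE.
by congr (Num.sqrt (_ * _)); apply: eq_bigr => i _; rewrite !mxE.
Qed.

Lemma metric_normE_pos x v : 0 < height x ->
  metric_norm x v = (height x)^-1 * Num.sqrt (\sum_i v ord0 i ^+ 2).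
Proof.
move=> y0; rewrite metric_normE sqrtrM ?invr_ge0 ?sqr_ge0//.
by rewrite -exprVn sqrtr_sqr ger0_norm// invr_ge0 ltW.
Qed.

Lemma is_derive_curve_coord h t i : derivable h t 1 ->
  is_derive t 1 (fun s => h s ord0 i) (derive1 h t ord0 i).
Proof.
move=> dh; rewrite derive1E derive_mx// mxE.
by apply: derivableP; exact: ((derivable_mxP _ _ _).1 dh).
Qed.

Variable x0 : 'rV[R]_n.+1.
Hypothesis b0 : 0 < height x0.

Definition radial_speed h t : R :=
  (\sum_i dcoshd x0 i (h t) * derive1 h t ord0 i) / height (h t).

Lemma is_derive_coshd_curve h t : derivable h t 1 -> 0 < height (h t) ->
  is_derive t 1 (fun s => coshd x0 (h s)) (radial_speed h t).
Proof.
move=> dh y0.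
have Hc i := is_derive_curve_coord i dh.
have H1 i : is_derive t 1 (fun s => (h s ord0 i - x0 ord0 i) ^+ 2)
    ((h t ord0 i - x0 ord0 i) * (derive1 h t ord0 i - 0) +
     (derive1 h t ord0 i - 0) * (h t ord0 i - x0 ord0 i)).
  have D := is_derive_sub (Hc i) (is_derive_cst (x0 ord0 i) t (1 : R)).
  exact: (is_derive_mul D D).
have H2 : is_derive t 1 (fun s => 2 * height x0 * height (h s))
   (2 * height x0 * (derive1 h t ord0 ord_max) + 0 * height (h t)).
  exact: (is_derive_mul (is_derive_cst (2 * height x0) t (1 : R)) (Hc ord_max)).
have c0 : 2 * height x0 * height (h t) != 0 by rewrite gt_eqF ?mulr_gt0.
have H3 := @is_derive_comp1 _ _ (fun z => z^-1) (fun s : R => 2 * height x0 * height (h s)) t 1 _ _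
  (@is_deriveV _ id (2 * height x0 * height (h t)) _ _ c0 (is_derive_id _ (1 : R))) H2.
have H4 := is_derive_add (is_derive_cst (1 : R) t (1 : R))
  (is_derive_mul (is_derive_bigsum H1) H3).
apply: (is_derive_eq H4).
rewrite /radial_speed /=; set S := \sum_i (_ ^+ 2).
have sE : coshd x0 (h t) - 1 = S * (2 * height x0 * height (h t))^-1.
  by rewrite /coshd addrC addKr.
have -> : \sum_i dcoshd x0 i (h t) * derive1 h t ord0 i =
  (height x0)^-1 * (\sum_i (h t ord0 i - x0 ord0 i) * derive1 h t ord0 i) -
   (coshd x0 (h t) - 1) * derive1 h t ord0 ord_max.
  rewrite /dcoshd mulr_sumr.
  under eq_bigr do rewrite mulrBl.
  rewrite sumrB; congr (_ - _); first by apply: eq_bigr => i _; ring.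
  rewrite (bigD1 ord_max)//= eqxx mul1r big1 ?addr0// => i /negbTE ->.
  by rewrite !mul0r.
under eq_bigr do rewrite subr0 [X in _ + X]mulrC -mulr2n -mulr_natl.
rewrite -mulr_sumr sE /GRing.scale /=.
by field; rewrite !gt_eqF.
Qed.

(** A version of [arccosh] that is smooth also at [s = 1], the value of
    [coshd x0] at [x0], where a curve ending at [x0] has to pass; it tends to
    [arccosh] as [w] tends to [0]. *)
Definition calibration (w s : R) : R := ln (s + Num.sqrt (s ^+ 2 - 1 + w ^+ 2)).

Lemma is_derive_calibration (w s : R) : 0 < w -> 1 <= s ->
  is_derive s 1 (calibration w) (Num.sqrt (s ^+ 2 - 1 + w ^+ 2))^-1.
Proof.
move=> w0 s1.
have r0 : 0 < s ^+ 2 - 1 + w ^+ 2.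
  by rewrite ltr_wpDl ?exprn_gt0// subr_ge0 exprn_ege1.
have q0 : 0 < Num.sqrt (s ^+ 2 - 1 + w ^+ 2) by rewrite sqrtr_gt0.
have a0 : 0 < s + Num.sqrt (s ^+ 2 - 1 + w ^+ 2).
  by rewrite addr_gt0// (lt_le_trans ltr01).
have Hi := is_derive_id s (1 : R).
have H1 : is_derive s 1 (fun z => z ^+ 2 - 1 + w ^+ 2) (s * 1 + 1 * s - 0 + 0).
  exact: (is_derive_add (is_derive_sub (is_derive_mul Hi Hi) (is_derive_cst (1 : R) s (1 : R)))
   (is_derive_cst (w ^+ 2) s (1 : R))).
have H2 := is_derive_add Hi (@is_derive_comp1 _ _ Num.sqrt
  (fun z : R => z ^+ 2 - 1 + w ^+ 2) s 1 _ _ (is_derive1_sqrt r0) H1).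
have H3 := @is_derive_comp1 _ _ (@ln R)
  (fun z : R => z + Num.sqrt (z ^+ 2 - 1 + w ^+ 2)) s 1 _ _ (is_derive1_ln a0) H2.
apply: (is_derive_eq H3); field.
by rewrite !gt_eqF.
Qed.

(** The gradient of [cosh r] has length [sinh r]. *)
Lemma radial_speed_le h t : 0 < height (h t) ->
  `|radial_speed h t| <= Num.sqrt (coshd x0 (h t) ^+ 2 - 1) * metric_norm (h t) (derive1 h t).
Proof.
move=> y0; rewrite metric_normE_pos// /radial_speed normrM.
rewrite [X in _ * X]gtr0_norm ?invr_gt0// mulrA [leRHS]mulrAC ler_pM2r ?invr_gt0//.
by apply: le_trans (cauchy_schwarz_sum _ _) _; rewrite sum_dcoshd2.
Qed.

Section one_piece.
Variables (h : R -> 'rV[R]_n.+1) (a c : R).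
Hypothesis hC1 : C1_curve h.
Hypothesis ac : a < c.
Hypothesis hpos : forall t, a <= t <= c -> 0 < height (h t).

Lemma continuous_curve_coord t i : {for t, continuous (fun s => h s ord0 i)}.
Proof.
have [dh _] := hC1; have [d _] := is_derive_curve_coord i (dh t).
exact/differentiable_continuous/derivable1_diffP.
Qed.

Lemma continuous_velocity_coord t i : {for t, continuous (fun s => derive1 h s ord0 i)}.
Proof.
have [_ ch] := hC1.
apply: (@continuous_comp _ _ _ (derive1 h) (fun v => v ord0 i)); first exact: ch.
exact: coord_continuous.
Qed.

Lemma continuous_speed t : a <= t <= c ->
  {for t, continuous (fun s => metric_norm (h s) (derive1 h s))}.
Proof.
move=> tac; rewrite (_ : (fun s => _) = (fun s =>
    Num.sqrt (height (h s) ^- 2 * \sum_i derive1 h s ord0 i ^+ 2))); last first.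
  by apply/funext => s; rewrite metric_normE.
apply: continuous_comp; last exact: sqrt_continuous.
apply: continuousM.
  apply: continuousV; first by rewrite expf_neq0// gt_eqF// hpos.
  have cy : {for t, continuous (fun s => height (h s))} by exact: continuous_curve_coord.
  exact: (continuousM cy cy).
have cs i : {for t, continuous (fun s => derive1 h s ord0 i ^+ 2)}.
  have cv := @continuous_velocity_coord t i.
  exact: (continuousM cv cv).
exact: continuous_bigsum cs.
Qed.

Lemma within_continuous_speed :
  {within `[a, c], continuous (fun s => metric_norm (h s) (derive1 h s))}.
Proof.
apply/(continuous_within_itvP _ ac); split.
- move=> t; rewrite in_itv/= => /andP[at_ tc]; apply: continuous_speed.
  by rewrite !ltW.
- by apply: cvg_at_right_filter; apply: continuous_speed; rewrite lexx ltW.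
- by apply: cvg_at_left_filter; apply: continuous_speed; rewrite lexx ltW.
Qed.

Lemma integrable_speed :
  mu.-integrable `[a, c] (EFin \o (fun s => metric_norm (h s) (derive1 h s))).
Proof.
by apply: continuous_compact_integrable; [exact: segment_compact|exact: within_continuous_speed].
Qed.

(** Along a curve the derivative of [calibration w] of [cosh r] is at most
    [sinh r / sqrt (sinh^2 r + w^2)] times the speed, hence at most the speed. *)
Lemma calibrated_piece (w : R) : 0 < w ->
  ((calibration w (coshd x0 (h a)) - calibration w (coshd x0 (h c)))%:E <=
    \int[mu]_(t in `[a, c]) (metric_norm (h t) (derive1 h t))%:E)%E.
Proof.
move=> w0; have [dh ch] := hC1.
pose F t := - calibration w (coshd x0 (h t)).
pose f t := - ((Num.sqrt (coshd x0 (h t) ^+ 2 - 1 + w ^+ 2))^-1 * radial_speed h t).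
have r0 t : a <= t <= c -> 0 < coshd x0 (h t) ^+ 2 - 1 + w ^+ 2.
  by move=> tac; rewrite ltr_wpDl ?exprn_gt0// subr_ge0 exprn_ege1// coshd_ge1// hpos.
have cs t : a <= t <= c -> {for t, continuous (fun s => coshd x0 (h s))}.
  move=> tac; have [d _] := is_derive_coshd_curve (dh t) (hpos tac).
  exact/differentiable_continuous/derivable1_diffP.
have dF t : a <= t <= c -> is_derive t 1 F (f t).
  move=> tac; apply: is_deriveN; apply: is_derive_comp1.
    by apply: is_derive_calibration => //; rewrite coshd_ge1// hpos.
  by apply: is_derive_coshd_curve => //; exact: hpos.
have cf t : a <= t <= c -> {for t, continuous f}.
  move=> tac; apply: continuousN; apply: continuousM.
    apply: continuousV; first by rewrite gt_eqF// sqrtr_gt0 r0.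
    apply: continuous_comp; last exact: sqrt_continuous.
    apply: continuousD; last exact: cst_continuous.
    apply: continuousB; last exact: cst_continuous.
    exact: (continuousM (cs t tac) (cs t tac)).
  apply: continuousM; last first.
    by apply: continuousV; [rewrite gt_eqF// hpos|exact: continuous_curve_coord].
  have cd i : {for t, continuous (fun s => dcoshd x0 i (h s) * derive1 h s ord0 i)}.
    apply: continuousM; last exact: continuous_velocity_coord.
    apply: continuousB.
      apply: continuousM; last exact: cst_continuous.
      by apply: continuousB; [exact: continuous_curve_coord|exact: cst_continuous].
    apply: continuousM; first exact: cst_continuous.
    by apply: continuousB; [exact: cs|exact: cst_continuous].
  exact: continuous_bigsum cd.
have := FTC_segment ac dF cf.
rewrite /F opprK [(- _ + _)%R]addrC => <-.
apply: le_integral => //.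
- apply: continuous_compact_integrable; first exact: segment_compact.
  apply/(continuous_within_itvP _ ac); split.
  + by move=> t; rewrite in_itv/= => /andP[at_ tc]; apply: cf; rewrite !ltW.
  + by apply: cvg_at_right_filter; apply: cf; rewrite lexx ltW.
  + by apply: cvg_at_left_filter; apply: cf; rewrite lexx ltW.
- exact: integrable_speed.
- move=> t; rewrite inE/= in_itv/= => tac; rewrite lee_fin /f.
  apply: le_trans (ler_norm _) _; rewrite normrN normrM gtr0_norm ?invr_gt0 ?sqrtr_gt0 ?r0//.
  rewrite ler_pdivrMl ?sqrtr_gt0 ?r0//.
  apply: le_trans (radial_speed_le (hpos tac)) _.
  by rewrite ler_wpM2r ?sqrtr_ge0// ler_wsqrtr// lerDl sqr_ge0.
Qed.

End one_piece.

End curves.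

Section distance_lower_bound.
Context {R : realType} {n : nat}.
Local Notation mu := (@lebesgue_measure R).
Implicit Types (x v : 'rV[R]_n.+1) (g h : R -> 'rV[R]_n.+1) (t : R).
Variable x0 : 'rV[R]_n.+1.
Hypothesis b0 : 0 < height x0.

Definition speed g t : R := metric_norm (g t) (derive1 g t).

Lemma speed_ge0 g t : 0 <= speed g t.
Proof. by rewrite /speed metric_normE sqrtr_ge0. Qed.

(** At the ends of a piece the derivatives of [g] and [h] may differ, so only the
    interior is claimed. *)
Lemma speed_piece g h (a c : R) : {in `[a, c], g =1 h} -> {in `]a, c[, speed g =1 speed h}.
Proof.
move=> gh t tac; rewrite /speed gh; last exact: subset_itv_oo_cc.
congr (metric_norm _ _); rewrite !derive1E.
apply: near_eq_derive; have : t \in `]a, c[%classic by rewrite inE.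
move=> /set_mem H; have o : nbhs t `]a, c[%classic.
  by apply: open_nbhs_nbhs; split => //; exact: itv_open.
by apply: filterS o => z /= zac; apply: gh; exact: subset_itv_oo_cc.
Qed.

Lemma measurable_speed_piece g h (a c : R) : a < c -> C1_curve h ->
  (forall t, a <= t <= c -> 0 < height (h t)) -> {in `[a, c], g =1 h} ->
  measurable_fun `[a, c] (speed g).
Proof.
move=> ac hC1 hpos gh; apply: (@measurable_fun_itv_cc _ _ _ false true).
apply: (@eq_measurable_fun _ _ _ _ _ (speed h)).
  by move=> t /set_mem tac; rewrite (speed_piece gh).
apply: (@measurable_funS _ _ _ _ `[a, c]%classic) => //; first exact: subset_itv_oo_cc.
by apply: subspace_continuous_measurable_fun => //; exact: within_continuous_speed.
Qed.

Lemma integral_speed_piece g h (a c : R) : a < c -> C1_curve h ->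
  (forall t, a <= t <= c -> 0 < height (h t)) -> {in `[a, c], g =1 h} ->
  (\int[mu]_(t in `[a, c]) (speed g t)%:E = \int[mu]_(t in `[a, c]) (speed h t)%:E)%E.
Proof.
move=> ac hC1 hpos gh.
have mh : measurable_fun `]a, c[ (fun t => (speed h t)%:E).
  apply/measurable_EFinP; apply: (@measurable_funS _ _ _ _ `[a, c]%classic) => //.
    exact: subset_itv_oo_cc.
  by apply: subspace_continuous_measurable_fun => //; exact: within_continuous_speed.
have mg : measurable_fun `]a, c[ (fun t => (speed g t)%:E).
  by apply: eq_measurable_fun mh => t /set_mem tac; rewrite (speed_piece gh).
apply: (etrans (integral_itv_bndoo true false mg)).
apply: (etrans _ (esym (integral_itv_bndoo true false mh))).
by apply: eq_integral => t /set_mem tac; rewrite (speed_piece gh).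
Qed.

(** The bounds of the pieces telescope. Finiteness of the length comes along,
    since the real-valued integral is only meaningful with it. *)
Lemma calibrated_curve g (w : R) (s : seq R) (a : R) : 0 < w ->
  path <%R a s ->
  (forall k, (k < size s)%N -> exists2 h, C1_curve h &
      {in `[nth 0 (a :: s) k, nth 0 s k], g =1 h}) ->
  (forall t, a <= t <= last a s -> 0 < height (g t)) ->
  [/\ measurable_fun `[a, last a s] (speed g),
   (\int[mu]_(t in `[a, last a s]) (speed g t)%:E < +oo)%E &
   ((calibration w (coshd x0 (g a)) - calibration w (coshd x0 (g (last a s))))%:E <=
     \int[mu]_(t in `[a, last a s]) (speed g t)%:E)%E].
Proof.
move=> w0; elim: s a => [a _ _ _|c s IH a /= /andP[ac pcs] gh gpos].
  rewrite /= set_itv1 integral_set1 subrr; split => //.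
  exact: measurable_fun_set1.
have [h hC1 gh0] := gh 0%N isT; rewrite /= in gh0.
have cl : c <= last c s.
  move: pcs; clear; elim: s c => //= d s IH c /andP[cd /IH]; apply: le_trans; exact: ltW.
have ghpos t : a <= t <= c -> 0 < height (h t).
  move=> /andP[at_ tc]; rewrite -gh0 ?in_itv/= ?at_//.
  by apply: gpos; rewrite at_ (le_trans tc).
have [] := IH c pcs.
- by move=> k ks; have := gh k.+1 ks.
- by move=> t /andP[ct tl]; apply: gpos; rewrite tl (le_trans (ltW ac)).
move=> m2 f2 l2.
have m1 := measurable_speed_piece ac hC1 ghpos gh0.
have i1 := integral_speed_piece ac hC1 ghpos gh0.
have l1 := calibrated_piece b0 hC1 ac ghpos w0.
have f1 : (\int[mu]_(t in `[a, c]) (speed g t)%:E < +oo)%E.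
  rewrite i1; have /integrableP[_] := integrable_speed hC1 ac ghpos.
  apply: le_lt_trans; rewrite le_eqVlt; apply/orP; left; apply/eqP.
  apply: eq_integral => t _; rewrite gee0_abs; first reflexivity.
  by rewrite lee_fin; exact: speed_ge0.
have split_itv : `[a, last c s]%classic = `[a, c[%classic `|` `[c, last c s]%classic.
  have H1 : (BLeft a <= BLeft c)%O by rewrite bnd_simp ltW.
  have H2 : (BLeft c <= BRight (last c s))%O by rewrite bnd_simp.
  exact: (itv_bndbnd_setU H1 H2).
have m1' : measurable_fun `[a, c[ (speed g) by apply: measurable_fun_itv_co m1.
have mU : measurable_fun (`[a, c[%classic `|` `[c, last c s]%classic) (speed g).
  exact: ((measurable_funU (speed g) (measurable_itv _) (measurable_itv _)).2 (conj m1' m2)).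
have iU : (\int[mu]_(t in `[a, last c s]) (speed g t)%:E =
   \int[mu]_(t in `[a, c]) (speed g t)%:E + \int[mu]_(t in `[c, last c s]) (speed g t)%:E)%E.
  rewrite split_itv ge0_integral_setU.
  - congr (_ + _)%E; apply: integral_itv_bndo_bndc; exact/measurable_EFinP.
  - exact: measurable_itv.
  - exact: measurable_itv.
  - exact/measurable_EFinP.
  - by move=> t _; rewrite lee_fin speed_ge0.
  - apply/disj_setPS => t [] /=; rewrite !in_itv/= => /andP[_ tc] /andP[ct _].
    by move: (lt_le_trans tc ct); rewrite ltxx.
split.
- by rewrite split_itv.
- by rewrite iU lte_add_pinfty.
- have aac : a \in `[a, c] by rewrite in_itv/= lexx (ltW ac).
  have cac : c \in `[a, c] by rewrite in_itv/= lexx (ltW ac).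
  have ea : g a = h a := gh0 a aac.
  have ec : g c = h c := gh0 c cac.
  rewrite -ea -ec -i1 in l1.
  rewrite iU; apply: le_trans (leeD l1 l2).
  by rewrite -EFinD lee_fin addrA subrK.
Qed.

Lemma coshd_self : coshd x0 x0 = 1.
Proof. by rewrite /coshd big1 ?mul0r ?addr0// => i _; rewrite subrr expr0n. Qed.

(** The error [calibration w 1 = ln (1 + w)] at the end of the curve is at most
    [w], which is arbitrary. *)
Lemma curve_length_ge x g : 0 < height x -> joining_curve x x0 g ->
  pole_dist x0 x <= curve_length g.
Proof.
move=> y0 [[s [ps ls gs]] gpos g0 g1].
apply/ler_addgt0Pr => w w0.
have [] := @calibrated_curve g w s 0 w0 ps gs.
  by move=> t; rewrite ls => t01; apply: gpos; rewrite in_itv.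
rewrite ls g0 g1 coshd_self => _ fin low.
have : calibration w (coshd x0 x) - calibration w 1 <= curve_length g.
  rewrite -lee_fin /curve_length /Rintegral fineK//.
  rewrite ge0_fin_numE//; apply: integral_ge0 => t _.
  by rewrite lee_fin speed_ge0.
have s1 := coshd_ge1 b0 y0.
have c1 : calibration w 1 <= w.
  rewrite /calibration expr1n subrr add0r sqrtr_sqr gtr0_norm//.
  by apply: le_ln1Dx; rewrite (lt_trans _ w0)// ltrN10.
have c2 : pole_dist x0 x <= calibration w (coshd x0 x).
  rewrite /pole_dist /acosh /calibration ler_ln ?posrE.
  - by rewrite lerD2l ler_wsqrtr// lerDl sqr_ge0.
  - exact: lt_le_trans ltr01 (acosh_arg_ge1 s1).
  - by rewrite ltr_pwDl ?sqrtr_ge0// (lt_le_trans ltr01).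
by move: c1 c2; lra.
Qed.

Lemma is_derive_segment x t : is_derive t (1 : R) (fun t : R => t *: (x0 - x) + x) (x0 - x).
Proof.
have dH : is_diff t (fun s : R => s *: (x0 - x)) (fun s : R => s *: (x0 - x)).
  exact: is_diff_scalel.
have df : differentiable (fun s : R => s *: (x0 - x)) t by exact: ex_diff.
have H : is_derive t (1 : R) (fun s : R => s *: (x0 - x)) (x0 - x).
  split; first exact: diff_derivable.
  by rewrite deriveE// diff_val scale1r.
exact: (is_derive_eq (is_deriveD H (is_derive_cst x t (1 : R))) (addr0 _)).
Qed.

Lemma joining_segment x : 0 < height x ->
  joining_curve x x0 (fun t => t *: (x0 - x) + x).
Proof.
move=> y0.
have D t := is_derive_segment x t.
have D1 : derive1 (fun t => t *: (x0 - x) + x) = cst (x0 - x).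
  by apply/funext => t; rewrite derive1E; have [_ ->] := D t.
split.
- exists [:: 1]; split => //=; first by rewrite ltr01.
  case=> // _; exists (fun t => t *: (x0 - x) + x) => //; split.
    by move=> t; have [] := D t.
  by rewrite D1; exact: cst_continuous.
- move=> t; rewrite in_itv/= => /andP[t0 t1].
  rewrite /halfspace /= !mxE -/(height x) -/(height x0).
  have -> : t * (height x0 - height x) + height x = t * height x0 + (1 - t) * height x by ring.
  move: t0; rewrite le_eqVlt => /predU1P[<-|t0].
    by rewrite mul0r add0r subr0 mul1r.
  by rewrite ltr_pwDl ?mulr_gt0// mulr_ge0 ?subr_ge0// ltW.
- by rewrite scale0r add0r.
- by rewrite scale1r subrK.
Qed.

End distance_lower_bound.

Section distance_bounds.
Context {R : realType} {n : nat}.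
Local Notation mu := (@lebesgue_measure R).
Implicit Types (x v : 'rV[R]_n.+1) (t : R).
Variable x0 : 'rV[R]_n.+1.
Hypothesis b0 : 0 < height x0.

Lemma geodesic_dist_ge x : 0 < height x -> pole_dist x0 x <= geodesic_dist x x0.
Proof.
move=> y0; apply: lb_le_inf.
  exists (curve_length (fun t => t *: (x0 - x) + x)).
  by exists (fun t => t *: (x0 - x) + x) => //; exact: joining_segment.
by move=> _ [g gj <-]; exact: curve_length_ge.
Qed.

(** A bound for the hyperbolic length of the Euclidean segment: on it the height
    is at least the smaller one of the heights of the ends. *)
Definition segment_bound x : R :=
  ((height x)^-1 + (height x0)^-1) * Num.sqrt (\sum_i (x0 - x) ord0 i ^+ 2).

Lemma curve_length_segment_le x : 0 < height x ->
  curve_length (fun t => t *: (x0 - x) + x) <= segment_bound x.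
Proof.
move=> y0; set g := fun t => t *: (x0 - x) + x.
have [[s [ps ls gs]] gpos g0 g1] := joining_segment b0 y0.
have dg t : is_derive t (1 : R) g (x0 - x) by exact: is_derive_segment.
have D1 : derive1 g = cst (x0 - x).
  by apply/funext => t; rewrite derive1E; have [_ ->] := dg t.
have gC1 : C1_curve g.
  split; first by move=> t; have [] := dg t.
  by rewrite D1; exact: cst_continuous.
have hpos t : 0 <= t <= 1 -> 0 < height (g t).
  by move=> t01; apply: gpos; rewrite in_itv.
have i1 := integrable_speed gC1 ltr01 hpos.
have i2 : mu.-integrable `[0, 1] (EFin \o cst (segment_bound x)).
  apply: continuous_compact_integrable; first exact: segment_compact.
  exact: continuous_subspaceT (@cst_continuous _ _ _).
have : (\int[mu]_(t in `[0%R, 1%R]) cst (segment_bound x) t)%R = segment_bound x.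
  rewrite Rintegral_cst//= lebesgue_measure_itv/= lte_fin ltr01 -EFinB subr0.
  by rewrite mulr1.
move=> <-; apply: le_Rintegral => //.
move=> t; rewrite /= in_itv/= => /[dup] t01 /andP[t0 t1].
rewrite metric_normE_pos ?hpos// D1 /segment_bound ler_wpM2r ?sqrtr_ge0//.
have hE : height (g t) = t * height x0 + (1 - t) * height x.
  by rewrite /height !mxE; ring.
have yi : 0 < (height x)^-1 by rewrite invr_gt0.
have bi : 0 < (height x0)^-1 by rewrite invr_gt0.
have [xb|/ltW xb] := leP (height x) (height x0).
  apply: (@le_trans _ _ (height x)^-1); last by lra.
  rewrite lef_pV2 ?posrE ?hpos// hE.
  have : t * height x <= t * height x0 by rewrite ler_wpM2l.
  by lra.
apply: (@le_trans _ _ (height x0)^-1); last by lra.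
rewrite lef_pV2 ?posrE ?hpos// hE.
have t1' : 0 <= 1 - t by lra.
have : (1 - t) * height x0 <= (1 - t) * height x by rewrite ler_wpM2l.
by lra.
Qed.

Lemma geodesic_dist_le x : 0 < height x -> geodesic_dist x x0 <= segment_bound x.
Proof.
move=> y0; apply: le_trans (curve_length_segment_le y0).
apply: ge_inf; last by exists (fun t => t *: (x0 - x) + x) => //; exact: joining_segment.
by exists (pole_dist x0 x) => _ [g gj <-]; exact: curve_length_ge.
Qed.

(** Makes the moment of the distance finite; an infinite one would count as [0]
    in the real-valued integral. *)
Lemma geodesic_dist_bounded (K : set 'rV[R]_n.+1) : compact K -> K `<=` halfspace ->
  exists M, 0 <= M /\ forall x, K x -> geodesic_dist x x0 <= M.
Proof.
move=> cK KH; have [K0|/set0P/negP/negPn/eqP K0] := pselect (K !=set0); last first.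
  by exists 0; split => // x; rewrite K0.
have c : {within K, continuous segment_bound}.
  apply: continuous_in_subspaceT => x /set_mem /KH y0.
  suff : {for x, continuous (fun z : 'rV[R]_n.+1 => ((height z)^-1 + (height x0)^-1) *
     Num.sqrt (\sum_i (x0 - z) ord0 i ^+ 2))} by [].
  apply: continuousM.
    apply: continuousD; last exact: cst_continuous.
    by apply: continuousV; [rewrite gt_eqF|exact: continuous_coord].
  apply: continuous_comp; last exact: sqrt_continuous.
  apply: continuous_bigsum => i.
  have ci : {for x, continuous (fun z : 'rV[R]_n.+1 => (x0 - z) ord0 i)}.
    rewrite (_ : (fun z => _) = (fun z : 'rV[R]_n.+1 => x0 ord0 i - z ord0 i)); last first.
      by apply/funext => z; rewrite !mxE.
    by apply: continuousB; [exact: cst_continuous|exact: continuous_coord].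
  exact: (continuousM ci ci).
have [m _ mmax] := EVT_max_rV K0 cK c.
exists `|segment_bound m|; split => // x Kx.
apply: le_trans (geodesic_dist_le (KH _ Kx)) _.
by apply: le_trans (mmax x _) (ler_norm _); rewrite inE.
Qed.

End distance_bounds.

Section nonmeasurable_monotonicity.
Context d (T : measurableType d) (R : realType) (mu : {measure set T -> \bar R}).

(** The integral of a nonnegative function is the supremum of the integrals of the
    simple functions below it. Moments of the distance, which is an infimum over
    curves, can therefore be compared without studying its measurability. *)
Lemma ge0_le_integral_nomeas (f g : T -> \bar R) :
  (forall x, 0 <= f x)%E -> (forall x, f x <= g x)%E ->
  (\int[mu]_x f x <= \int[mu]_x g x)%E.
Proof.
move=> f0 fg; have g0 x : (0 <= g x)%E by apply: le_trans (fg x).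
rewrite !ge0_integralTE//; apply: le_ereal_sup => _ [h hf <-].
by exists h => // x; apply: le_trans (fg x); exact: hf.
Qed.

Lemma ge0_le_Rintegral_nomeas (f g k : T -> R) :
  mu.-integrable setT (EFin \o k) ->
  (forall x, 0 <= f x) -> (forall x, f x <= g x) -> (forall x, g x <= k x) ->
  (\int[mu]_x f x <= \int[mu]_x g x)%R.
Proof.
move=> ik f0 fg gk.
have g0 x : 0 <= g x by apply: le_trans (fg x).
have k0 x : 0 <= k x by apply: le_trans (gk x).
have kfin : (\int[mu]_x (k x)%:E < +oo)%E.
  have /integrableP[_] := ik; apply: le_lt_trans.
  by apply: ge0_le_integral_nomeas => x; rewrite /= lee_fin ?ger0_norm.
have gle : (\int[mu]_x (g x)%:E <= \int[mu]_x (k x)%:E)%E.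
  by apply: ge0_le_integral_nomeas => x; rewrite lee_fin.
have fle : (\int[mu]_x (f x)%:E <= \int[mu]_x (g x)%:E)%E.
  by apply: ge0_le_integral_nomeas => x; rewrite lee_fin.
have gfin : (\int[mu]_x (g x)%:E < +oo)%E by apply: le_lt_trans kfin.
apply: fine_le => //.
  rewrite ge0_fin_numE; first exact: le_lt_trans gfin.
  by apply: integral_ge0 => x _; rewrite lee_fin.
rewrite ge0_fin_numE//.
by apply: integral_ge0 => x _; rewrite lee_fin.
Qed.

End nonmeasurable_monotonicity.

(** * The uncertainty inequality *)
Section uncertainty.
Context {R : realType}.

(** The best radius is [(B / A)^((p - 1) / p)]. For [B = 0] all radii are allowed and the
    lower bounds of [D] are unbounded, so this only happens with [A = 0]. *)
Lemma optimize_radius (p C A B D : R) : 1 < p -> 0 < C -> 0 <= A -> 0 <= B ->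
  (A = 0 -> 0 <= D) ->
  (forall rho, 0 < rho -> B <= rho `^ (p / (p - 1)) * A -> C * A / rho `^ p <= D) ->
  C * A `^ p <= D * B `^ (p - 1).
Proof.
move=> p1 C0 A0 B0 D0 H.
have p0 : 0 < p by lra.
have pB1 : 0 < p - 1 by lra.
set q := p / (p - 1) in H; have q0 : 0 < q by rewrite divr_gt0.
move: A0; rewrite le_eqVlt => /predU1P[A0|A0].
  by rewrite -A0 powR0 ?gt_eqF// mulr0 mulr_ge0 ?powR_ge0// D0.
move: B0; rewrite le_eqVlt => /predU1P[B0|B0].
  (* [z] is the value of [rho^p] for which the lower bound of [D] is [|D| + 1]. *)
  exfalso; pose z := C * A / (`|D| + 1).
  have z0 : 0 < z by rewrite divr_gt0 ?mulr_gt0// ltr_wpDl.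
  have zp : (z `^ p^-1) `^ p = z by rewrite -powRrM mulVf ?gt_eqF// powRr1// ltW.
  have := H (z `^ p^-1) (powR_gt0 _ z0).
  rewrite -B0 mulr_ge0 ?powR_ge0 ?(ltW A0)// => /(_ isT); rewrite zp.
  have -> : C * A / z = `|D| + 1.
    by rewrite /z; field; rewrite !gt_eqF// ltr_wpDl.
  by have := ler_norm D; lra.
have BA : 0 < B / A by rewrite divr_gt0.
have rq : ((B / A) `^ q^-1) `^ q = B / A by rewrite -powRrM mulVf ?gt_eqF// powRr1// ltW.
have := H _ (powR_gt0 q^-1 BA); rewrite rq divfK ?gt_eqF// lexx => /(_ isT).
have -> : ((B / A) `^ q^-1) `^ p = (B / A) `^ (p - 1).
  by rewrite -powRrM; congr (_ `^ _); rewrite /q; field; rewrite !gt_eqF.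
have Bp : 0 < B `^ (p - 1) by rewrite powR_gt0.
have Ap : 0 < A `^ (p - 1) by rewrite powR_gt0.
rewrite powR_div ?(ltW B0)//.
move=> /(ler_wpM2r (ltW Bp)); apply: le_trans.
rewrite -(mulr_powRB1 (ltW A0) p0) le_eqVlt; apply/orP; left; apply/eqP; field.
by rewrite !gt_eqF.
Qed.

End uncertainty.

Theorem corollary2p4 (R : realType) (n : nat) (p : R)
    (x0 : 'rV[R]_n.+1) (u : 'rV[R]_n.+1 -> R) :
  let N : R := n.+1%:R in
  let Lambda := ((N - 1) / p) `^ p in
  let p' := p / (p - 1) in
  let r := fun x => geodesic_dist x x0 in
  2 <= p ->
  1 + p * (p - 1) <= N ->
  halfspace x0 ->
  test_function u ->
  (p - 1) * ((N - 1) / p) `^ (p - 2) * ((p - 1) / p) ^+ 2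
    * hyp_integral (fun x => `|u x| `^ p) `^ p
  <= (hyp_integral (fun x => metric_norm x (gradient u x) `^ p)
      - Lambda * hyp_integral (fun x => `|u x| `^ p))
     * hyp_integral (fun x => `|u x| `^ p * r x `^ p') `^ (p / p').
Proof.
move=> N Lambda p' r p2 pN hx0 tu; rewrite /Lambda.
have b0 : 0 < height x0 by [].
have p0 : 0 < p by lra.
have pB1 : 0 < p - 1 by lra.
have NE : N - 1 = n%:R by rewrite /N -natr1 addrK.
have q0 : 0 < p' by rewrite divr_gt0.
rewrite NE; set a := n%:R / p.
have pa : p - 1 <= a by rewrite /a ler_pdivlMr// -NE; lra.
have a0 : 0 < a by lra.
have u0 x : ~ halfspace x -> u x = 0 by exact: test_function_height.
have f0 x : ~ halfspace x -> `|u x| `^ p = 0.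
  by move=> /u0 ->; rewrite normr0 powR0// gt_eqF.
have AE := hyp_integralE f0.
have gE x : metric_norm x (gradient u x) `^ p * density x =
    `|gradient_length u x| `^ p * density x.
  have [y0|y0] := pselect (0 < height x).
    rewrite gradient_normE// -/(gradient_length u x) ger0_norm//.
    by rewrite mulr_ge0 ?sqrtr_ge0// ltW.
  have [_ _ KH] := tu.
  have pu i : partial i u x = 0 by apply: test_function_partial0 => /KH.
  have -> : gradient_length u x = 0.
    rewrite /gradient_length big1 ?sqrtr0 ?mulr0// => i _.
    by rewrite pu expr0n.
  have -> : gradient u x = 0.
    rewrite /gradient (_ : differential_row u x = 0) ?mul0mx//.
    by apply/rowP => i; rewrite !mxE pu.
  by rewrite /metric_norm !mul0mx mxE sqrtr0 normr0.
have g0 x : ~ halfspace x -> metric_norm x (gradient u x) `^ p = 0.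
  move=> y0; have [_ _ KH] := tu.
  have -> : gradient u x = 0.
    rewrite /gradient (_ : differential_row u x = 0) ?mul0mx//.
    by apply/rowP => i; rewrite !mxE; apply: test_function_partial0 => /KH.
  by rewrite /metric_norm !mul0mx mxE sqrtr0 powR0// gt_eqF.
have EE : hyp_integral (fun x => metric_norm x (gradient u x) `^ p) =
    integ (fun x => `|gradient_length u x| `^ p * density x).
  by rewrite (hyp_integralE g0); congr integ; apply/funext => x; exact: gE.
have m0 x : ~ halfspace x -> `|u x| `^ p * r x `^ p' = 0.
  by move=> /f0 ->; rewrite mul0r.
have BE := hyp_integralE m0.
have d0 x : 0 < height x -> 0 < density x by move=> y0; rewrite invr_gt0 exprn_gt0.
have [_ cK KH] := tu.
have [M [M0 HM]] := geodesic_dist_bounded b0 cK KH.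
have moment : integ (fun x => `|u x| `^ p * `|pole_dist x0 x| `^ p' * density x) <=
    integ (fun x => `|u x| `^ p * r x `^ p' * density x).
  have cM := CcZ (M `^ p') (Cc_mass p2 tu).
  apply: (ge0_le_Rintegral_nomeas (Cc_integrable cM)) => t /=; set x := row_of_tuple t.
  - have [y0|/u0 ->] := pselect (halfspace x).
      by rewrite !mulr_ge0 ?powR_ge0// ltW// d0.
    by rewrite normr0 powR0 ?mul0r// gt_eqF.
  - have [y0|/u0 ->] := pselect (halfspace x); last first.
      by rewrite normr0 powR0 ?mul0r// gt_eqF.
    rewrite ler_pM2r ?d0// ler_wpM2l ?powR_ge0//.
    have R0 := pole_dist_ge0 b0 y0; have R1 := geodesic_dist_ge b0 y0.
    rewrite ger0_norm// ge0_ler_powR ?nnegrE ?(ltW q0)//.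
    exact: le_trans R0 R1.
  - have [Kx|/(test_function0 (u := u)) ->] := pselect (closure [set x | u x != 0] x); last first.
      by rewrite normr0 powR0 ?mul0r ?mulr0// gt_eqF.
    have y0 := KH _ Kx.
    rewrite mulrA ler_pM2r ?d0// mulrC ler_wpM2r ?powR_ge0//.
    have R0 := pole_dist_ge0 b0 y0; have R1 := geodesic_dist_ge b0 y0.
    rewrite ge0_ler_powR ?nnegrE ?(ltW q0) ?M0 ?HM//.
    exact: le_trans R0 R1.
rewrite AE EE BE.
set A := integ (fun x => `|u x| `^ p * density x).
set E := integ (fun x => `|gradient_length u x| `^ p * density x).
set B := integ (fun x => `|u x| `^ p * r x `^ p' * density x) in moment *.
have dge0 x : halfspace x -> 0 <= density x by move=> /d0 /ltW.
have A0 : 0 <= A.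
  apply: Rintegral_ge0 => t _; have [y0|/u0 ->] := pselect (halfspace (row_of_tuple t)).
    by apply: mulr_ge0; [exact: powR_ge0|exact: dge0].
  by rewrite normr0 powR0 ?mul0r// gt_eqF.
have B0 : 0 <= B.
  apply: Rintegral_ge0 => t _; have [y0|/u0 ->] := pselect (halfspace (row_of_tuple t)).
    by apply: mulr_ge0; [apply: mulr_ge0; exact: powR_ge0|exact: dge0].
  by rewrite normr0 powR0 ?mul0r// gt_eqF.
have E0 : 0 <= E.
  apply: Rintegral_ge0 => t _; rewrite -gE.
  have [y0|/g0 ->] := pselect (halfspace (row_of_tuple t)); last by rewrite mul0r.
  by apply: mulr_ge0; [exact: powR_ge0|exact: dge0].
have -> : p / p' = p - 1 by rewrite /p'; field; rewrite !gt_eqF.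
apply: (@optimize_radius _ p _ A B); [by move: p2; clear; lra| |exact: A0|exact: B0| |].
- by apply: mulr_gt0; [apply: mulr_gt0 => //; exact: powR_gt0|apply: exprn_gt0; exact: divr_gt0].
- by move=> ->; rewrite mulr0 subr0.
move=> rho rho0 Brho.
have := energy_gap p2 pa b0 tu rho0 (le_trans moment Brho).
rewrite -/A -/E /hardy_level /hardy_const => H.
rewrite lerBrDr; apply: le_trans H; rewrite le_eqVlt; apply/orP; left; apply/eqP.
by field; rewrite !gt_eqF// powR_gt0.
Qed.
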